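(* Let $\overline g$ be a modified Patterson–Walker metric on $\widetilde M$ with Schouten tensor $\overline{\mathrm{P}}$, and let $t\in\mathbb{R}_+$, $\rho\in\mathbb{R}$ be the additional coordinates on the ambient manifold $\widetilde M\times\mathbb{R}_+\times\mathbb{R}$. Then $$\mathbf{g}=2\rho\,dt\odot dt+2t\,dt\odot d\rho+t^2\big(\overline g+2\rho\,\overline{\mathrm{P}}\big)$$ is a globally Ricci-flat Fefferman–Graham ambient metric of the conformal class of $\overline g$.
   Context: $a\odot b=\frac12(a\otimes b+b\otimes a)$. On a manifold of dimension $2n$ the Schouten tensor of a metric with Ricci tensor $\mathrm{Ric}$ and scalar curvature $S$ is $\mathrm{P}=\frac{1}{2n-2}\big(\mathrm{Ric}-\frac{S}{2(2n-1)}g\big)$. Modified PW metric: let $D$ be a special (i.e. preserving a volume form) torsion-free affine connection on an oriented manifold $M$ of dimension $n\ge2$. Let $\mathcal{E}(2)=(\Lambda^nTM)^{2/(n+1)}$ and $\pi:\widetilde M\to M$, $\widetilde M=T^*M\otimes\mathcal{E}(2)$, identified with $T^*M$ by the $D$-parallel volume form; $T\widetilde M=V\oplus H$ with $V\cong\pi^*T^*M$ vertical and $H\cong\pi^*TM$ the horizontal distribution of $D$. $\widetilde g$ is the split-signature metric making $V$ and $H$ isotropic and pairing them naturally; in coordinates $\widetilde g=2\,dx^A\odot dp_A-2\Gamma_A{}^C{}_Bp_C\,dx^A\odot dx^B$. For a symmetric tensor $\Phi_{AB}\in S^2T^*M\otimes\mathcal{E}(2)$, the modified PW metric is $\overline g=\widetilde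 g+\pi^*\Phi$. A Fefferman–Graham ambient metric (in normal form) of the conformal class $[g]$ is a Ricci-flat metric of the form $2\rho\,dt\odot dt+2t\,dt\odot d\rho+t^2g(\rho)$, where $g(\rho)$ is a smooth 1-parameter family of metrics with $g(0)=g$. In general Ricci-flatness is only required asymptotically at $\rho=0$; ''globally Ricci-flat'' means Ricci-flat everywhere, not only asymptotically. *)

(* Defs.v *)
From HB Require Import structures.
From mathcomp Require Import all_boot all_order all_algebra.
From mathcomp Require Import all_classical all_reals all_analysis.

Set Implicit Arguments.
Unset Strict Implicit.
Unset Printing Implicit Defensive.

Import Order.TTheory GRing.Theory Num.Theory.
Import numFieldNormedType.Exports.

Local Open Scope classical_set_scope.
Local Open Scope ring_scope.

Definition partial (R : realType) (m : nat) (a : 'I_m)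
    (f : 'rV[R]_m -> R) : 'rV[R]_m -> R :=
  fun x => 'D_(delta_mx 0 a) f x.

(* C^infinity on an open set U: every iterated partial derivative is
   differentiable at every point of U. *)
Definition smooth_on (R : realType) (m : nat) (U : set 'rV[R]_m)
    (f : 'rV[R]_m -> R) : Prop :=
  forall (s : seq 'I_m) (x : 'rV[R]_m),
    U x -> differentiable (foldr (@partial R m) f s) x.

Record manifold (R : realType) (n : nat) := Manifold {
  carrier :> topologicalType;
  manifold_hausdorff : hausdorff_space carrier;
  manifold_second_countable : @second_countable carrier;
  chart_index : Type;
  chart_dom : chart_index -> set carrier;
  chart : chart_index -> carrier -> 'rV[R]_n;
  chart_inv : chart_index -> 'rV[R]_n -> carrier;
  chart_cover : forall q, exists i, chart_dom i q;
  chart_dom_open : forall i, open (chart_dom i);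
  chart_img_open : forall i, open (chart i @` chart_dom i);
  chartK : forall i q, chart_dom i q -> chart_inv i (chart i q) = q;
  chart_continuous : forall i, {within chart_dom i, continuous (chart i)};
  chart_inv_continuous : forall i,
    {within chart i @` chart_dom i, continuous (chart_inv i)};
  chart_smooth : forall i j (a : 'I_n),
    smooth_on (chart i @` (chart_dom i `&` chart_dom j))
              (fun x => chart j (chart_inv i x) 0 a)
}.

(* Gluing data of an m-dimensional manifold: chart i has image [cdom i], its
   intersection with chart j has image [overlap i j] in the coordinates of
   chart i, and [trans i j] is the change of coordinates from i to j there. *)
Record charts (R : realType) (m : nat) := Charts {
  cindex : Type;
  cdom : cindex -> set 'rV[R]_m;
  overlap : cindex -> cindex -> set 'rV[R]_m;
  trans : cindex -> cindex -> 'rV[R]_m -> 'rV[R]_m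
}.

Definition local_charts (R : realType) (n : nat) (M : manifold R n) :
    charts R n :=
  {| cindex := chart_index M;
     cdom := fun i => chart i @` chart_dom i;
     overlap := fun i j => chart i @` (chart_dom i `&` chart_dom j);
     trans := fun i j x => chart j (chart_inv i x) |}.

(* T^*M with coordinates (x, p); a covector changes by
   p'_B = \sum_A (dx^A / dx'^B) p_A.  The library's Jacobian acts on row
   vectors from the right: ['J f x a b] is the derivative of f^b along x^a. *)
Definition cotangent (R : realType) (n : nat) (C : charts R n) :
    charts R (n + n) :=
  {| cindex := cindex C;
     cdom := fun i => [set z | cdom i (lsubmx z)];
     overlap := fun i j => [set z | overlap i j (lsubmx z)];
     trans := fun i j z =>
       row_mx (trans i j (lsubmx z))
              (rsubmx z *m ('J (trans j i) (trans i j (lsubmx z)))^T) |}.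

Definition coord_t (R : realType) (m : nat) (z : 'rV[R]_(m + 2)) : R :=
  z 0 (rshift m ord0).
Definition coord_rho (R : realType) (m : nat) (z : 'rV[R]_(m + 2)) : R :=
  z 0 (rshift m ord_max).

(* N * R_+ * R with coordinates (y, t, rho). *)
Definition ambient (R : realType) (m : nat) (C : charts R m) :
    charts R (m + 2) :=
  {| cindex := cindex C;
     cdom := fun i => [set z | cdom i (lsubmx z) /\ 0 < coord_t z];
     overlap := fun i j => [set z | overlap i j (lsubmx z) /\ 0 < coord_t z];
     trans := fun i j z => row_mx (trans i j (lsubmx z)) (rsubmx z) |}.

Definition oriented (R : realType) (m : nat) (C : charts R m) : Prop :=
  forall (i j : cindex C) x, overlap i j x -> 0 < \det ('J (trans i j) x).

(* Components T_ab of a covariant 2-tensor in every chart. *)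
Definition field2 (R : realType) (m : nat) (C : charts R m) : Type :=
  cindex C -> 'rV[R]_m -> 'M[R]_m.

Definition smooth_field2 (R : realType) (m : nat) (C : charts R m)
    (T : field2 C) : Prop :=
  forall i a b, smooth_on (cdom i) (fun x => T i x a b).

Definition sym_tensor (R : realType) (m : nat) (C : charts R m)
    (T : field2 C) : Prop :=
  [/\ smooth_field2 T,
      forall i x, cdom i x -> (T i x)^T = T i x &
      forall i j x, overlap i j x ->
        T i x = 'J (trans i j) x *m T j (trans i j x) *m ('J (trans i j) x)^T].

(* Pseudo-Riemannian metrics, of any signature. *)
Definition metric (R : realType) (m : nat) (C : charts R m)
    (g : field2 C) : Prop :=
  sym_tensor g /\ forall i x, cdom i x -> g i x \in unitmx.

(* Symmetric 2-tensors with values in (Lambda^m TN)^w, N oriented; the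
   components are relative to the frame (d_1 /\ ... /\ d_m)^w, which is
   (det J)^w times the one of the other chart. *)
Definition weighted_sym_tensor (R : realType) (m : nat) (C : charts R m)
    (w : R) (T : field2 C) : Prop :=
  [/\ smooth_field2 T,
      forall i x, cdom i x -> (T i x)^T = T i x &
      forall i j x, overlap i j x ->
        T i x = (\det ('J (trans i j) x)) `^ (- w) *:
          ('J (trans i j) x *m T j (trans i j x) *m ('J (trans i j) x)^T)].

(* [G x c a b] is the coefficient of d_c in the derivative of d_b along d_a. *)
Definition coeffs (R : realType) (m : nat) : Type :=
  'rV[R]_m -> 'I_m -> 'I_m -> 'I_m -> R.

Definition affine_connection (R : realType) (m : nat) (C : charts R m)
    (G : cindex C -> coeffs R m) : Prop :=
  (forall i c a b, smooth_on (cdom i) (fun x => G i x c a b)) /\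
  (forall (i j : cindex C) x, overlap i j x -> forall a b e,
     let J := 'J (trans i j) x in
     \sum_c G i x c a b * J c e =
       \sum_f \sum_h J a f * J b h * G j (trans i j x) e f h
       + partial a (partial b (fun y => trans i j y 0 e)) x).

Definition torsion_free (R : realType) (m : nat) (C : charts R m)
    (G : cindex C -> coeffs R m) : Prop :=
  forall (i : cindex C) x, cdom i x -> forall c a b, G i x c a b = G i x c b a.

(* The component on d_1 /\ ... /\ d_m of a positive volume form. *)
Definition volume_form (R : realType) (m : nat) (C : charts R m)
    (v : cindex C -> 'rV[R]_m -> R) : Prop :=
  [/\ forall i, smooth_on (cdom i) (v i),
      forall i x, cdom i x -> 0 < v i x &
      forall i j x, overlap i j x ->
        v i x = \det ('J (trans i j) x) * v j (trans i j x)].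

Definition preserves (R : realType) (m : nat) (C : charts R m)
    (G : cindex C -> coeffs R m) (v : cindex C -> 'rV[R]_m -> R) : Prop :=
  forall (i : cindex C) x, cdom i x -> forall a,
    partial a (v i) x = (\sum_c G i x c a c) * v i x.

Definition levi_civita (R : realType) (m : nat) (g : 'rV[R]_m -> 'M[R]_m) :
    coeffs R m :=
  fun x c a b => 2^-1 * \sum_d invmx (g x) c d *
    (partial a (fun y => g y b d) x + partial b (fun y => g y a d) x
     - partial d (fun y => g y a b) x).

Definition ricci (R : realType) (m : nat) (G : coeffs R m)
    (x : 'rV[R]_m) : 'M[R]_m :=
  \matrix_(a, b) \sum_c
    (partial c (fun y => G y c a b) x - partial b (fun y => G y c a c) x
     + \sum_d (G x c c d * G x d a b - G x c b d * G x d a c)).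

Definition ricci_metric (R : realType) (m : nat) (g : 'rV[R]_m -> 'M[R]_m) :
    'rV[R]_m -> 'M[R]_m := ricci (levi_civita g).

Definition scalar_curvature (R : realType) (m : nat)
    (g : 'rV[R]_m -> 'M[R]_m) (x : 'rV[R]_m) : R :=
  \sum_a \sum_b invmx (g x) a b * ricci_metric g x a b.

(* Used with m = 2n. *)
Definition schouten (R : realType) (m : nat) (g : 'rV[R]_m -> 'M[R]_m)
    (x : 'rV[R]_m) : 'M[R]_m :=
  (m%:R - 2)^-1 *:
    (ricci_metric g x - (scalar_curvature g x / (2 * (m%:R - 1))) *: g x).

Definition schouten_tensor (R : realType) (m : nat) (C : charts R m)
    (g P : field2 C) : Prop :=
  sym_tensor P /\ forall i x, cdom i x -> P i x = schouten (g i) x.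

Definition ricci_flat (R : realType) (m : nat) (C : charts R m)
    (g : field2 C) : Prop :=
  forall i x, cdom i x -> ricci_metric (g i) x = 0.

Definition odot (R : realType) (m : nat) (a b : 'rV[R]_m) : 'M[R]_m :=
  2^-1 *: (a^T *m b + b^T *m a).

(* Pullback of a 2-tensor along the projection onto the first m coordinates. *)
Definition pullback (R : realType) (m k : nat) (T : 'M[R]_m) : 'M[R]_(m + k) :=
  block_mx T 0 0 0.

Definition dx (R : realType) (n : nat) (A : 'I_n) : 'rV[R]_(n + n) :=
  delta_mx 0 (lshift n A).
Definition dp (R : realType) (n : nat) (A : 'I_n) : 'rV[R]_(n + n) :=
  delta_mx 0 (rshift n A).
Definition dt (R : realType) (m : nat) : 'rV[R]_(m + 2) :=
  delta_mx 0 (rshift m ord0).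
Definition drho (R : realType) (m : nat) : 'rV[R]_(m + 2) :=
  delta_mx 0 (rshift m ord_max).

Definition pw_metric (R : realType) (n : nat) (G : coeffs R n)
    (z : 'rV[R]_(n + n)) : 'M[R]_(n + n) :=
  \sum_A 2 *: odot (dx R A) (dp R A)
  - \sum_A \sum_B
      (2 * \sum_K G (lsubmx z) K A B * rsubmx z 0 K) *: odot (dx R A) (dx R B).

(* The parallel volume form v identifies (T^*M)(2) with T^*M and, multiplying
   components by v^(2/(n+1)), sections of S^2 T^*M (2) with symmetric tensors;
   p are the fibre coordinates of T^*M after this identification. *)
Definition modified_pw_metric (R : realType) (n : nat) (C : charts R n)
    (G : cindex C -> coeffs R n) (v : cindex C -> 'rV[R]_n -> R)
    (Phi : field2 C) (g : field2 (cotangent C)) : Prop :=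
  metric g /\
  forall (i : cindex C) z, cdom i (lsubmx z) ->
    g i z = pw_metric (G i) z
      + pullback n (v i (lsubmx z) `^ (2 / n.+1%:R) *: Phi i (lsubmx z)).

Definition smooth_family_of_metrics (R : realType) (m : nat) (C : charts R m)
    (h : R -> field2 C) : Prop :=
  (forall rho, metric (h rho)) /\
  forall (i : cindex C) a b,
    smooth_on [set w : 'rV[R]_(m + 1) | cdom i (lsubmx w)]
      (fun w => h (w 0 (rshift m ord0)) i (lsubmx w) a b).

Definition ambient_normal_form (R : realType) (m : nat) (C : charts R m)
    (h : R -> field2 C) : field2 (ambient C) :=
  fun i z =>
    (2 * coord_rho z) *: odot (dt R m) (dt R m)
    + (2 * coord_t z) *: odot (dt R m) (drho R m)
    + coord_t z ^+ 2 *: pullback 2 (h (coord_rho z) i (lsubmx z)).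

Definition globally_ricci_flat_ambient_metric (R : realType) (m : nat)
    (C : charts R m) (g : field2 C) (bg : field2 (ambient C)) : Prop :=
  [/\ exists h : R -> field2 C,
        [/\ smooth_family_of_metrics h,
            forall (i : cindex C) y, cdom i y -> h 0 i y = g i y &
            forall (i : cindex C) z, @cdom R (m + 2) (ambient C) i z ->
              bg i z = ambient_normal_form h i z],
      metric bg &
      ricci_flat bg].

(* Main.v *)
Require Import Defs.
From HB Require Import structures.
From mathcomp Require Import all_boot all_order all_algebra.
From mathcomp Require Import all_classical all_reals all_analysis.
From mathcomp Require Import ring.

Set Implicit Arguments.
Unset Strict Implicit.
Unset Printing Implicit Defensive.

Import Order.TTheory GRing.Theory Num.Theory.
Import numFieldNormedType.Exports.

Local Open Scope classical_set_scope.
Local Open Scope ring_scope.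

(** In a chart (x, p) of the cotangent bundle the modified metric is the block
    matrix with rows (W, 1) and (1, 0), where W_AB = - 2 G^C_AB p_C + Psi_AB.
    The coefficients G of the connection D and the symmetric tensor Psi, which
    is Phi rescaled by the volume form, are functions of x alone.  The inverse
    matrix has rows (0, 1) and (1, - W).  Two features of this shape carry the
    whole proof.

    First, the Levi-Civita coefficients are affine in p, those pointing along
    the base are the ones of D, and their traces vanish.  The Ricci tensor then
    comes out as the pullback of Ric(D) plus its transpose, whatever Psi is
    ([ricci_pw]).  A pullback has trace zero, because the base-base block of
    the inverse metric is zero; so the scalar curvature vanishes and the
    Schouten tensor P is the pullback of a tensor Q on the base
    ([schouten_pw]).

    Second, gbar + 2 rho P is again of the same shape, with Psi + 2 rho Q in
    place of Psi ([slice_pw]).  Hence its Ricci tensor does not depend on rho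
    and is equal to (2n - 2) P, while P composed with itself through the
    inverse metric, its trace and its divergence vanish, by the zero block
    again ([endo_pw]).

    For a metric in normal form whose slices h(rho) = g0 + 2 rho P satisfy
    these conditions the Levi-Civita coefficients are explicit.  With m the
    dimension of the slices, the Ricci tensor has at most three kinds of
    components: Ric(h) - (m - 2) P along two slice directions, the divergence of
    P, and the trace of the square of P ([ricci_fg]).  All of them vanish, for
    every rho and not only asymptotically at rho = 0 ([ricci_ambient_pw]).

    That the ambient components form a smooth nondegenerate tensor follows from
    the block-diagonal Jacobian of a change of ambient charts, once the changes
    of charts of the cotangent bundle are known to be differentiable. *)

(** * Derivatives along lines *)

Section DirectionalDerivative.
Context {R : realType}.

(** Along the fibres of the cotangent bundle, and along the coordinates t and
    rho, the functions to be differentiated are polynomials of degree at most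
    two (up to 1 / t): their derivatives need no smoothness of the coefficients,
    which may themselves be derivatives of other functions. *)
Lemma derive_quadratic (V : normedModType R) (f : V -> R) (x v : V) (d e : R) :
  (forall s, f (s *: v + x) = f x + s * d + s ^+ 2 * e) -> 'D_v f x = d.
Proof.
move=> fE; apply/cvg_lim => //=.
have E : \forall h \near 0^', d + h * e = h^-1 *: (f (h *: v + x) - f x).
  near=> h.
  have h0 : h != 0 by near: h; exact: nbhs_dnbhs_neq.
  rewrite fE /GRing.scale /=; field.
  exact: h0.
have lim : d + h * e @[h --> 0^'] --> d.
  rewrite -[X in _ --> X]addr0 -[X in _ --> _ + X](mul0r e).
  apply: cvgD; first exact: cvg_cst.
  by apply: cvgM; [exact: nbhs_dnbhs | exact: cvg_cst].
exact: cvg_trans (near_eq_cvg E) lim.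
Unshelve. all: by end_near. Qed.

Lemma derive_affine (V : normedModType R) (f : V -> R) (x v : V) (d : R) :
  (forall s, f (s *: v + x) = f x + s * d) -> 'D_v f x = d.
Proof.
move=> fE; apply: (@derive_quadratic _ _ _ _ _ 0) => s.
by rewrite fE mulr0 addr0.
Qed.

Lemma derive_constant_along (V : normedModType R) (f : V -> R) (x v : V) :
  (forall s, f (s *: v + x) = f x) -> 'D_v f x = 0.
Proof.
by move=> fE; apply: (@derive_affine _ f x v 0) => s; rewrite fE mulr0 addr0.
Qed.

(** The difference quotients only see the restriction to the line.  This turns
    partial derivatives on a product into partial derivatives on a factor, again
    without any differentiability. *)
Lemma derive_same_line (V W : normedModType R) (f : V -> R) (g : W -> R)
    (x v : V) (y w : W) :
  (forall s, f (s *: v + x) = g (s *: w + y)) -> 'D_v f x = 'D_w g y.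
Proof.
move=> fg; have fx : f x = g y by have := fg 0; rewrite !scale0r !add0r.
rewrite /derive.
have -> : (fun h => h^-1 *: ((f \o shift x) (h *: v) - f x))
    = (fun h => h^-1 *: ((g \o shift y) (h *: w) - g y)).
  by apply: funext => h /=; rewrite fg fx.
by [].
Qed.

Lemma partial_eq_on m (U : set 'rV[R]_m) (a : 'I_m) (f g : 'rV[R]_m -> R) x :
  open U -> U x -> (forall y, U y -> f y = g y) ->
  partial a f x = partial a g x.
Proof.
move=> oU Ux fg; apply: near_eq_derive.
by apply: (filterS fg); exact: open_nbhs_nbhs.
Qed.

Lemma partial_coordinate m (a b : 'I_m) x :
  partial a (fun y : 'rV[R]_m => y 0 b) x = (a == b)%:R.
Proof.
apply: derive_affine => s; rewrite !mxE eqxx /= eq_sym addrC.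
by case: (a == b); rewrite ?mulr1 ?mulr0.
Qed.

(** The shape of the components of the metric restricted to p = const: the
    weights [c] are the momenta. *)
Lemma partial_combination m p (a : 'I_m) (c : 'I_p -> R)
    (f : 'I_p -> 'rV[R]_m -> R) (g : 'rV[R]_m -> R) (k : R) x :
  (forall i, differentiable (f i) x) -> differentiable g x ->
  partial a (fun y => k * (\sum_i f i y * c i) + g y) x
  = k * (\sum_i partial a (f i) x * c i) + partial a g x.
Proof.
move=> df dg; rewrite /partial.
have -> : (fun y => k * (\sum_i f i y * c i) + g y)
    = k *: (\sum_i (c i *: f i)) + g.
  apply: funext => y; rewrite [RHS]/(_ + _) /= [X in _ = X + _]/(_ *: _) /=.
  rewrite fct_sumE; congr (_ * _ + _); apply: eq_bigr => i _.
  by rewrite mulrC.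
have dfi i : is_derive x (delta_mx 0 a) (f i) ('D_(delta_mx 0 a) (f i) x).
  by apply: derivableP; exact: diff_derivable.
have dgx : is_derive x (delta_mx 0 a) g ('D_(delta_mx 0 a) g x).
  by apply: derivableP; exact: diff_derivable.
rewrite derive_val; congr (_ * _ + _); apply: eq_bigr => i _.
by rewrite mulrC.
Qed.

End DirectionalDerivative.

(** * Product coordinates *)

(** In the names below, the suffixes l and r stand for indices of the first and
    of the second factor. *)
Section Splitting.
Context {R : realType} {m k : nat}.
Implicit Type z : 'rV[R]_(m + k).

Lemma split_lshift (i : 'I_m) : fintype.split (lshift k i) = inl i.
Proof. exact: (unsplitK (inl i)). Qed.

Lemma split_rshift (i : 'I_k) : fintype.split (rshift m i) = inr i.
Proof. exact: (unsplitK (inr i)). Qed.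

Lemma lsubmx_line_l s (i : 'I_m) z :
  lsubmx (s *: delta_mx 0 (lshift k i) + z) = s *: delta_mx 0 i + lsubmx z.
Proof. by apply/rowP => j; rewrite !mxE eq_lshift. Qed.

Lemma rsubmx_line_l s (i : 'I_m) z :
  rsubmx (s *: delta_mx 0 (lshift k i) + z) = rsubmx z.
Proof. by apply/rowP => j; rewrite !mxE eq_rlshift andbF mulr0 add0r. Qed.

Lemma lsubmx_line_r s (i : 'I_k) z :
  lsubmx (s *: delta_mx 0 (rshift m i) + z) = lsubmx z.
Proof. by apply/rowP => j; rewrite !mxE eq_lrshift andbF mulr0 add0r. Qed.

Lemma rsubmx_line_r s (i : 'I_k) z :
  rsubmx (s *: delta_mx 0 (rshift m i) + z) = s *: delta_mx 0 i + rsubmx z.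
Proof. by apply/rowP => j; rewrite !mxE eq_rshift. Qed.

Lemma partial_r_pullback (F : 'rV[R]_m -> R) (i : 'I_k) z :
  partial (rshift m i) (fun y => F (lsubmx y)) z = 0.
Proof. by apply: derive_constant_along => s; rewrite lsubmx_line_r. Qed.

Lemma open_pullback (U : set 'rV[R]_m) :
  open U -> open [set z : 'rV[R]_(m + k) | U (lsubmx z)].
Proof.
move=> oU; apply: (open_comp (f := lsubmx)) oU => z _.
exact: continuous_lsubmx.
Qed.

End Splitting.

Lemma differentiable_pullback (R : realType) (m k : nat) (F : 'rV[R]_m -> R)
    (y : 'rV[R]_(m + k)) :
  differentiable F (lsubmx y) -> differentiable (fun z => F (lsubmx z)) y.
Proof.
by move=> dF; apply: (@differentiable_comp _ _ _ _ lsubmx) => //;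
  exact: differentiable_lsubmx.
Qed.

Lemma pullback_entry (R : realType) (n k : nat) (T : 'M[R]_n)
    (a b : 'I_(n + k)) :
  pullback k T a b
  = match fintype.split a, fintype.split b with
    | inl A, inl B => T A B
    | _, _ => 0
    end.
Proof.
rewrite -{1}(splitK a) -{1}(splitK b) /pullback.
by case: (fintype.split a) => A; case: (fintype.split b) => B /=;
  rewrite ?(block_mxEul, block_mxEur, block_mxEdl, block_mxEdr) ?mxE.
Qed.

(** * Smooth functions and Jacobians *)

Section Smoothness.
Context {R : realType}.

(** The first-order expansion of [f] at [x] is one for [g], so the differential
    of [f] is that of [g]. *)
Lemma differentiable_near_eq m (f g : 'rV[R]_m -> R) x :
  (\forall y \near x, f y = g y) -> differentiable f x -> differentiable g x.
Proof.
move=> fg df.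
have gE : g \o shift x = cst (g x) + 'd f x +o_ 0 id.
  apply/eqaddoP => _/posnumP[e].
  have /eqaddoP/(_ e%:num)/(_ [gt0 of e%:num]) := diff_locally df.
  have fg0 : \forall h \near 0, f (h + x) = g (h + x).
    by move: fg; rewrite [\forall y \near x, _](near_shift 0) subr0;
      apply: filterS => h.
  apply: filter_app; near=> h.
  rewrite !opprD -![(_ + _ : _ -> _) _]/(_ + _) -![(- _ : _ -> _) _]/(- _).
  rewrite /cst /=.
  by rewrite (near fg0 h)// (nbhs_singleton fg).
have dg := diff_unique (diff_continuous df) gE.
apply/diff_locallyP; rewrite dg; split => //.
exact: diff_continuous.
Unshelve. all: by end_near. Qed.

Lemma smooth_on_differentiable m (U : set 'rV[R]_m) f x :
  smooth_on U f -> U x -> differentiable f x.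
Proof. by move=> /(_ [::] x). Qed.

Lemma smooth_on_partial m (U : set 'rV[R]_m) f a :
  smooth_on U f -> smooth_on U (partial a f).
Proof. by move=> sf s x Ux; have := sf (rcons s a) x Ux; rewrite foldr_rcons. Qed.

Lemma sub_smooth_on m (U V : set 'rV[R]_m) f :
  V `<=` U -> smooth_on U f -> smooth_on V f.
Proof. by move=> VU sf s x /VU; exact: sf. Qed.

(** An iterated partial derivative starting in [S] never leaves [S], up to
    equality on [U].  Equality elsewhere cannot be asked for: outside [U] the
    partial derivatives have no known value. *)
Lemma smooth_on_stable m (U : set 'rV[R]_m) (S : ('rV[R]_m -> R) -> Prop) :
  open U ->
  (forall f x, S f -> U x -> differentiable f x) ->
  (forall f a, S f ->
     exists2 f', S f' & forall x, U x -> partial a f x = f' x) ->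
  forall f g, S f -> (forall x, U x -> g x = f x) -> smooth_on U g.
Proof.
move=> oU dS pS f g Sf gf s.
have [f' Sf' gf'] : exists2 f', S f' &
    forall x, U x -> foldr (@partial R m) g s x = f' x.
  elim: s => [|a s [f1 Sf1 gf1]] /=; first by exists f.
  have [f2 Sf2 f12] := pS _ a Sf1; exists f2 => // x Ux.
  by rewrite (partial_eq_on a oU Ux gf1) f12.
move=> x Ux; apply: differentiable_near_eq (dS _ _ Sf' Ux).
have nU : nbhs x U by exact: open_nbhs_nbhs.
by apply: filterS nU => y /gf' ->.
Qed.

Lemma eq_smooth_on m (U : set 'rV[R]_m) f g :
  open U -> (forall x, U x -> g x = f x) -> smooth_on U f -> smooth_on U g.
Proof.
move=> oU gf sf; apply: (smooth_on_stable (S := smooth_on U) oU _ _ sf) => //.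
- by move=> f' x sf' Ux; exact: smooth_on_differentiable sf' Ux.
- by move=> f' a sf'; exists (partial a f') => //; exact: smooth_on_partial.
Qed.

(** The Leibniz rule turns the derivative of a product into a sum of products,
    so that sums and products have to be closed up together before
    [smooth_on_stable] applies. *)
Inductive smooth_combination m (U : set 'rV[R]_m) : ('rV[R]_m -> R) -> Prop :=
| SmoothBase f : smooth_on U f -> smooth_combination U f
| SmoothAdd f g : smooth_combination U f -> smooth_combination U g ->
    smooth_combination U (f + g)
| SmoothMul f g : smooth_combination U f -> smooth_combination U g ->
    smooth_combination U (f * g).

Lemma smooth_combination_differentiable m (U : set 'rV[R]_m) f x :
  smooth_combination U f -> U x -> differentiable f x.
Proof.
move=> Sf Ux; elim: Sf => [f' sf'|f1 f2 _ d1 _ d2|f1 f2 _ d1 _ d2].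
- exact: smooth_on_differentiable sf' Ux.
- exact: differentiableD.
- exact: differentiableM.
Qed.

Lemma smooth_combination_smooth m (U : set 'rV[R]_m) f :
  open U -> smooth_combination U f -> smooth_on U f.
Proof.
move=> oU Sf; apply: (smooth_on_stable oU _ _ Sf) => //.
  by move=> ? ?; exact: smooth_combination_differentiable.
move=> {Sf}f' a; elim=> [g sg|g1 g2 S1 [h1 Sh1 E1] S2 [h2 Sh2 E2]
    |g1 g2 S1 [h1 Sh1 E1] S2 [h2 Sh2 E2]].
- by exists (partial a g) => //; apply/SmoothBase/smooth_on_partial.
- exists (h1 + h2); first exact: SmoothAdd.
  move=> x Ux; rewrite /partial deriveD; first by
    rewrite -/(partial a g1 x) -/(partial a g2 x) E1// E2.
  + exact/diff_derivable/(smooth_combination_differentiable S1).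
  + exact/diff_derivable/(smooth_combination_differentiable S2).
- exists (g1 * h2 + g2 * h1).
    by apply: SmoothAdd; exact: SmoothMul.
  move=> x Ux; rewrite /partial deriveM; first by
    rewrite -/(partial a g1 x) -/(partial a g2 x) E1// E2.
  + exact/diff_derivable/(smooth_combination_differentiable S1).
  + exact/diff_derivable/(smooth_combination_differentiable S2).
Qed.

Lemma smooth_onD m (U : set 'rV[R]_m) f g : open U ->
  smooth_on U f -> smooth_on U g -> smooth_on U (fun x => f x + g x).
Proof.
move=> oU sf sg; apply: (smooth_combination_smooth oU).
by apply: SmoothAdd; exact: SmoothBase.
Qed.

Lemma smooth_onM m (U : set 'rV[R]_m) f g : open U ->
  smooth_on U f -> smooth_on U g -> smooth_on U (fun x => f x * g x).
Proof.
move=> oU sf sg; apply: (smooth_combination_smooth oU).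
by apply: SmoothMul; exact: SmoothBase.
Qed.

Lemma smooth_on_cst m (U : set 'rV[R]_m) (c : R) : smooth_on U (fun=> c).
Proof.
move=> s x _.
have [c' ->] : exists c', foldr (@partial R m) (fun=> c) s = cst c'.
  elim: s => [|a s [c' /= ->]]; first by exists c.
  by exists 0; apply: funext => y; exact: derive_cst.
exact: differentiable_cst.
Qed.

Lemma smooth_on_coord m (U : set 'rV[R]_m) (b : 'I_m) :
  smooth_on U (fun x => x 0 b).
Proof.
move=> s x _; elim/last_ind: s => [|s a _] /=; first exact: differentiable_coord.
rewrite foldr_rcons (_ : partial a _ = fun=> (a == b)%:R).
  exact: (@smooth_on_cst _ setT).
by apply: funext => y; exact: partial_coordinate.
Qed.

Lemma smooth_on_pullback m k (U : set 'rV[R]_m) f : smooth_on U f ->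
  smooth_on [set z : 'rV[R]_(m + k) | U (lsubmx z)] (fun z => f (lsubmx z)).
Proof.
move=> sf s x Ux.
have [f' sf' ->] : exists2 f', smooth_on U f'
    & foldr (@partial R (m + k)) (fun z => f (lsubmx z)) s = f' \o lsubmx.
  elim: s => [|a s [f' sf' /= ->]]; first by exists f.
  rewrite -(splitK a); case: (fintype.split a) => i /=.
    exists (partial i f'); first exact: smooth_on_partial.
    apply: funext => z; apply: derive_same_line => r /=.
    by rewrite lsubmx_line_l.
  exists (fun=> 0); first exact: smooth_on_cst.
  by apply: funext => z; exact: partial_r_pullback.
apply: differentiable_comp; first exact: differentiable_lsubmx.
exact: smooth_on_differentiable sf' Ux.
Qed.

End Smoothness.

Section Jacobian.
Context {R : realType}.

Lemma differentiable_row m k (F : 'rV[R]_m -> 'rV[R]_k) x :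
  (forall b, differentiable (fun y => F y 0 b) x) -> differentiable F x.
Proof.
move=> dF; have -> : F = \sum_b (fun y => F y 0 b *: delta_mx 0 b).
  by apply: funext => y; rewrite fct_sumE -row_sum_delta.
by apply: differentiable_sum => b; exact/differentiableZl/dF.
Qed.

Lemma jacobian_entry m k (F : 'rV[R]_m -> 'rV[R]_k) x a b :
  differentiable F x -> 'J F x a b = partial a (fun y => F y 0 b) x.
Proof.
move=> dF; rewrite /partial.
have <- : ('D_(delta_mx 0 a) F x) 0 b = 'D_(delta_mx 0 a) (fun y => F y 0 b) x.
  by rewrite derive_mx ?mxE//; exact: diff_derivable.
by rewrite deriveEjacobian// -rowE [RHS]mxE.
Qed.

End Jacobian.

(** Differentiability of tensors on the base is read off from tensors on the
    total space by restricting to p = 0. *)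
Lemma differentiable_zero_section (R : realType) (m k : nat)
    (F : 'rV[R]_(m + k) -> R) (x : 'rV[R]_m) :
  differentiable F (row_mx x 0) -> differentiable (fun y => F (row_mx y 0)) x.
Proof.
move=> dF; apply: (@differentiable_comp _ _ _ _ (fun y => row_mx y 0)) => //.
apply: differentiable_row => b; rewrite -(splitK b).
case: (fintype.split b) => e; rewrite [unsplit _]/=.
  rewrite (_ : (fun y => _) = (fun y : 'rV[R]_m => y 0 e)).
    exact: differentiable_coord.
  by apply: funext => y; rewrite row_mxEl.
rewrite (_ : (fun y => _) = cst 0); first exact: differentiable_cst.
by apply: funext => y; rewrite row_mxEr mxE.
Qed.

(** * Levi-Civita coefficients and Ricci tensor *)

Section Curvature.
Context {R : realType} {m : nat}.
Implicit Types (g : 'rV[R]_m -> 'M[R]_m) (x : 'rV[R]_m).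

Lemma koszul g x (d a b : 'I_m) : g x \in unitmx ->
  \sum_c g x d c * levi_civita g x c a b = 2^-1 *
    (partial a (fun y => g y b d) x + partial b (fun y => g y a d) x
     - partial d (fun y => g y a b) x).
Proof.
move=> gu; pose v : 'cV[R]_m := \col_e
  (2^-1 * (partial a (fun y => g y b e) x + partial b (fun y => g y a e) x
     - partial e (fun y => g y a b) x)).
transitivity ((g x *m (invmx (g x) *m v)) d 0); last by rewrite mulKVmx// mxE.
rewrite mxE; apply: eq_bigr => c _; congr (_ * _).
rewrite mxE /levi_civita mulr_sumr; apply: eq_bigr => e _.
by rewrite mxE mulrCA.
Qed.

(** The Koszul formula determines the coefficients, so they can be checked
    against [g] without computing its inverse. *)
Lemma levi_civita_unique g x (L : 'I_m -> R) (a b : 'I_m) :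
  g x \in unitmx ->
  (forall d, \sum_e g x d e * L e = 2^-1 *
    (partial a (fun y => g y b d) x + partial b (fun y => g y a d) x
     - partial d (fun y => g y a b) x)) ->
  forall c, levi_civita g x c a b = L c.
Proof.
move=> gu koszul c; rewrite /levi_civita mulr_sumr.
under eq_bigr do rewrite mulrCA -koszul.
pose u : 'cV[R]_m := \col_e L e.
have -> : L c = (invmx (g x) *m (g x *m u)) c 0 by rewrite mulKmx// mxE.
rewrite mxE; apply: eq_bigr => d _; rewrite mxE; congr (_ * _).
by apply: eq_bigr => e _; rewrite mxE.
Qed.

(** The Ricci tensor takes derivatives of the coefficients, hence equality at
    [x] alone would not do. *)
Lemma ricci_eq_on (U : set 'rV[R]_m) (G G' : coeffs R m) x :
  open U -> U x -> (forall y, U y -> forall c a b, G y c a b = G' y c a b) ->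
  ricci G x = ricci G' x.
Proof.
move=> oU Ux GG'; apply/matrixP => a b; rewrite !mxE; apply: eq_bigr => c _.
have eqp k c' a' b' :
    partial k (fun y => G y c' a' b') x = partial k (fun y => G' y c' a' b') x.
  by apply: (partial_eq_on _ oU Ux) => y Uy; exact: GG'.
by rewrite !eqp; congr (_ + _); apply: eq_bigr => d _; rewrite !GG'.
Qed.

End Curvature.

Section Locality.
Context {R : realType} {m : nat} (U : set 'rV[R]_m).
Hypothesis oU : open U.

Lemma ricci_metric_eq_on (g g' : 'rV[R]_m -> 'M[R]_m) x :
  U x -> (forall y, U y -> g y = g' y) -> ricci_metric g x = ricci_metric g' x.
Proof.
move=> Ux gg'; apply: (ricci_eq_on oU Ux) => y Uy c a b.
have eqp e a' b' :
    partial e (fun y => g y a' b') y = partial e (fun y => g' y a' b') y.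
  by apply: (partial_eq_on _ oU Uy) => w Uw; rewrite gg'.
by rewrite /levi_civita gg'//; congr (_ * _); apply: eq_bigr => d _; rewrite !eqp.
Qed.

Lemma schouten_eq_on (g g' : 'rV[R]_m -> 'M[R]_m) x :
  U x -> (forall y, U y -> g y = g' y) -> schouten g x = schouten g' x.
Proof.
move=> Ux gg'; have ric := ricci_metric_eq_on Ux gg'.
have scal : scalar_curvature g x = scalar_curvature g' x.
  by apply: eq_bigr => a _; apply: eq_bigr => b _; rewrite ric gg'.
by rewrite /schouten scal ric gg'.
Qed.

End Locality.

(** * Curvature of Patterson-Walker metrics *)

Section PattersonWalker.
Context {R : realType} {n : nat}.
Variables (G : coeffs R n) (Psi : 'rV[R]_n -> 'M[R]_n).
Implicit Type z : 'rV[R]_(n + n).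

Definition pw_base_block z : 'M[R]_n :=
  \matrix_(A, B) (- 2 * (\sum_K G (lsubmx z) K A B * rsubmx z 0 K)
                  + Psi (lsubmx z) A B).

(** The chart expression of the modified metric, see [pw_formE]. *)
Definition pw_form z : 'M[R]_(n + n) :=
  block_mx (pw_base_block z) 1%:M 1%:M 0.

(** The derivative of [pw_base_block] in the base direction [C], with [p] kept
    explicit so that it can be differentiated along the fibre. *)
Definition pw_base_partial z (C A B : 'I_n) : R :=
  - 2 * (\sum_K partial C (fun x => G x K A B) (lsubmx z) * rsubmx z 0 K)
  + partial C (fun x => Psi x A B) (lsubmx z).

(** The Levi-Civita coefficients.  The base components are those of [G] because
    the inverse metric pairs the base only with the fibre; the mixed ones come
    from the slope - 2 G of the base block in [p].  The contraction over [c] and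
    [b] is G^C_AC - G^C_AC = 0. *)
Definition pw_coeffs : coeffs R (n + n) := fun z c a b =>
  let x := lsubmx z in
  match fintype.split c, fintype.split a, fintype.split b with
  | inl C, inl A, inl B => G x C A B
  | inr C, inl A, inl B =>
      2^-1 * (pw_base_partial z A B C + pw_base_partial z B A C
              - pw_base_partial z C A B)
      - \sum_D pw_base_block z C D * G x D A B
  | inr C, inl A, inr B => - G x B A C
  | inr C, inr A, inl B => - G x A B C
  | _, _, _ => 0
  end.

Lemma pw_form_inv z :
  pw_form z *m block_mx 0 1%:M 1%:M (- pw_base_block z) = 1%:M.
Proof.
rewrite mulmx_block !mulmx0 !mul0mx !mulmx1 !mul1mx addr0 add0r subrr.
by rewrite addr0 -scalar_mx_block.
Qed.

Lemma pw_form_unit z : pw_form z \in unitmx.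
Proof. by have /mulmx1_unit[] := pw_form_inv z. Qed.

Lemma invmx_pw_form z :
  invmx (pw_form z) = block_mx 0 1%:M 1%:M (- pw_base_block z).
Proof.
rewrite -[RHS]mul1mx -(mulVmx (pw_form_unit z)) -mulmxA.
by rewrite pw_form_inv mulmx1.
Qed.

Variable U : set 'rV[R]_n.
Hypothesis oU : open U.
Hypothesis G_sym : forall x, U x -> forall c a b, G x c a b = G x c b a.
Hypothesis G_diff :
  forall x, U x -> forall c a b, differentiable (fun y => G y c a b) x.
Hypothesis Psi_diff :
  forall x, U x -> forall a b, differentiable (fun y => Psi y a b) x.
Hypothesis Psi_sym : forall x, U x -> forall a b, Psi x a b = Psi x b a.

Lemma partial_l_pw_base_block z C A B : U (lsubmx z) ->
  partial (lshift n C) (fun y => pw_base_block y A B) z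
  = pw_base_partial z C A B.
Proof.
move=> Uz.
rewrite -[RHS](@partial_combination R n n C) => [|i|]; last first.
- exact: Psi_diff.
- exact: G_diff.
apply: derive_same_line => s.
by rewrite mxE lsubmx_line_l rsubmx_line_l.
Qed.

Lemma sum_line_r (F : 'I_n -> R) s C (p : 'rV[R]_n) :
  \sum_K F K * (s *: delta_mx 0 C + p) 0 K
  = s * F C + \sum_K F K * p 0 K.
Proof.
under eq_bigr do rewrite 2!mxE mulrDr; rewrite big_split /=; congr (_ + _).
rewrite (bigD1 C)//= mxE !eqxx mulr1 big1 ?addr0 1?mulrC// => i iC.
by rewrite mxE (negbTE iC) !mulr0.
Qed.

Lemma pw_base_block_line_r s C z A B :
  pw_base_block (s *: delta_mx 0 (rshift n C) + z) A B
  = pw_base_block z A B + s * (- 2 * G (lsubmx z) C A B).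
Proof.
rewrite ![pw_base_block _ _ _]mxE lsubmx_line_r rsubmx_line_r.
by rewrite (sum_line_r (fun K => G (lsubmx z) K A B)); ring.
Qed.

Lemma pw_base_partial_line_r s C z E A B :
  pw_base_partial (s *: delta_mx 0 (rshift n C) + z) E A B
  = pw_base_partial z E A B
    + s * (- 2 * partial E (fun x => G x C A B) (lsubmx z)).
Proof.
rewrite /pw_base_partial lsubmx_line_r rsubmx_line_r.
rewrite (sum_line_r (fun K => partial E (fun x => G x K A B) (lsubmx z))).
by ring.
Qed.

Lemma partial_r_pw_base_block z C A B :
  partial (rshift n C) (fun y => pw_base_block y A B) z
  = - 2 * G (lsubmx z) C A B.
Proof. by apply: derive_affine => s; exact: pw_base_block_line_r. Qed.

Lemma pw_base_block_sym z A B : U (lsubmx z) ->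
  pw_base_block z A B = pw_base_block z B A.
Proof.
move=> Uz; rewrite !mxE Psi_sym//; congr (_ * _ + _).
by apply: eq_bigr => K _; rewrite G_sym.
Qed.

Lemma partial_pw_form_ll z c A B :
  partial c (fun y => pw_form y (lshift n A) (lshift n B)) z
  = partial c (fun y => pw_base_block y A B) z.
Proof. by congr (partial _ _ _); apply: funext => y; rewrite block_mxEul. Qed.

Lemma partial_pw_form_lr z c A B :
  partial c (fun y => pw_form y (lshift n A) (rshift n B)) z = 0.
Proof. by apply: derive_constant_along => s; rewrite !block_mxEur. Qed.

Lemma partial_pw_form_rl z c A B :
  partial c (fun y => pw_form y (rshift n A) (lshift n B)) z = 0.
Proof. by apply: derive_constant_along => s; rewrite !block_mxEdl. Qed.

Lemma partial_pw_form_rr z c A B :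
  partial c (fun y => pw_form y (rshift n A) (rshift n B)) z = 0.
Proof. by apply: derive_constant_along => s; rewrite !block_mxEdr. Qed.

Definition partial_pw_formE :=
  (partial_pw_form_ll, partial_pw_form_lr, partial_pw_form_rl,
   partial_pw_form_rr).

Lemma sum_delta (F : 'I_n -> R) (D : 'I_n) :
  \sum_C (1%:M : 'M[R]_n) D C * F C = F D.
Proof.
rewrite (bigD1 D)//= mxE eqxx mul1r big1 ?addr0// => C CD.
by rewrite mxE eq_sym (negbTE CD) mul0r.
Qed.

Lemma sum_pw_form_l z (F : 'I_(n + n) -> R) D :
  \sum_c pw_form z (lshift n D) c * F c
  = \sum_C pw_base_block z D C * F (lshift n C) + F (rshift n D).
Proof.
rewrite big_split_ord /=; congr (_ + _).
  by apply: eq_bigr => C _; rewrite block_mxEul.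
rewrite -[RHS](sum_delta (fun C => F (rshift n C))).
by apply: eq_bigr => C _; rewrite block_mxEur.
Qed.

Lemma sum_pw_form_r z (F : 'I_(n + n) -> R) D :
  \sum_c pw_form z (rshift n D) c * F c = F (lshift n D).
Proof.
rewrite big_split_ord /= [X in _ + X]big1 => [|C _]; last first.
  by rewrite block_mxEdr mxE mul0r.
rewrite addr0 -[RHS](sum_delta (fun C => F (lshift n C))).
by apply: eq_bigr => C _; rewrite block_mxEdl.
Qed.

Lemma levi_civita_pw z c a b : U (lsubmx z) ->
  levi_civita pw_form z c a b = pw_coeffs z c a b.
Proof.
move=> Uz.
apply: (@levi_civita_unique _ _ _ _ (fun c => pw_coeffs z c a b)) => [|d].
  exact: pw_form_unit.
rewrite -(splitK d) -(splitK a) -(splitK b).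
case: (fintype.split d) => D; case: (fintype.split a) => A;
  case: (fintype.split b) => B /=;
  rewrite !partial_pw_formE ?partial_l_pw_base_block// ?partial_r_pw_base_block
    ?sum_pw_form_l ?sum_pw_form_r /pw_coeffs ?split_lshift ?split_rshift;
  try under eq_bigr do rewrite ?split_lshift ?mulr0;
  rewrite ?big1_eq ?[X in X + _]addrC ?subrK//; by field.
Qed.

(** [Psi] disappears here: it does not depend on [p], and neither do the
    coefficients of [G] by which it is multiplied. *)
Lemma partial_pw_coeffs_vertical z C A B :
  partial (rshift n C)
    (fun y => pw_coeffs y (rshift n C) (lshift n A) (lshift n B)) z
  = partial C (fun x => G x C A B) (lsubmx z)
    - partial A (fun x => G x C B C) (lsubmx z)
    - partial B (fun x => G x C A C) (lsubmx z)
    + 2 * \sum_D G (lsubmx z) C C D * G (lsubmx z) D A B.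
Proof.
apply: derive_affine => s.
rewrite /pw_coeffs !split_rshift !split_lshift !pw_base_partial_line_r.
have -> : \sum_D pw_base_block (s *: delta_mx 0 (rshift n C) + z) C D
      * G (lsubmx (s *: delta_mx 0 (rshift n C) + z)) D A B
    = \sum_D pw_base_block z C D * G (lsubmx z) D A B
      - 2 * s * \sum_D G (lsubmx z) C C D * G (lsubmx z) D A B.
  rewrite mulr_sumr -sumrB; apply: eq_bigr => D _.
  by rewrite pw_base_block_line_r lsubmx_line_r; ring.
by field.
Qed.

Lemma partial_l_pw_coeffs_ll z E C A B :
  partial (lshift n E)
    (fun y => pw_coeffs y (lshift n C) (lshift n A) (lshift n B)) z
  = partial E (fun x => G x C A B) (lsubmx z).
Proof.
apply: derive_same_line => s.
by rewrite /pw_coeffs !split_lshift lsubmx_line_l.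
Qed.

Lemma partial_l_pw_coeffs_lr z E C A B : U (lsubmx z) ->
  partial (lshift n E)
    (fun y => pw_coeffs y (rshift n C) (lshift n A) (rshift n B)) z
  = - partial E (fun x => G x B A C) (lsubmx z).
Proof.
move=> Uz; rewrite /partial -deriveN; last exact/diff_derivable/G_diff.
apply: derive_same_line => s.
by rewrite /pw_coeffs split_rshift !split_lshift split_rshift lsubmx_line_l.
Qed.

Lemma partial_r_pw_coeffs_ll z E C A B :
  partial (rshift n E)
    (fun y => pw_coeffs y (lshift n C) (lshift n A) (lshift n B)) z = 0.
Proof.
apply: derive_constant_along => s.
by rewrite /pw_coeffs !split_lshift lsubmx_line_r.
Qed.

Lemma partial_r_pw_coeffs_lr z E C A B :
  partial (rshift n E)
    (fun y => pw_coeffs y (rshift n C) (lshift n A) (rshift n B)) z = 0.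
Proof.
apply: derive_constant_along => s.
by rewrite /pw_coeffs split_rshift !split_lshift split_rshift lsubmx_line_r.
Qed.

Lemma partial_r_pw_coeffs_rl z E C A B :
  partial (rshift n E)
    (fun y => pw_coeffs y (rshift n C) (rshift n A) (lshift n B)) z = 0.
Proof.
apply: derive_constant_along => s.
by rewrite /pw_coeffs !split_rshift !split_lshift lsubmx_line_r.
Qed.

Lemma partial_pw_coeffs_l_lr z e C A B :
  partial e (fun y => pw_coeffs y (lshift n C) (lshift n A) (rshift n B)) z = 0.
Proof.
apply: derive_constant_along => s.
by rewrite /pw_coeffs !split_rshift !split_lshift.
Qed.

Lemma partial_pw_coeffs_l_r z e C A b :
  partial e (fun y => pw_coeffs y (lshift n C) (rshift n A) b) z = 0.
Proof.
apply: derive_constant_along => s.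
by rewrite /pw_coeffs !split_rshift !split_lshift.
Qed.

Lemma partial_pw_coeffs_rr z e c A B :
  partial e (fun y => pw_coeffs y c (rshift n A) (rshift n B)) z = 0.
Proof.
apply: derive_constant_along => s.
by rewrite /pw_coeffs !split_rshift; case: (fintype.split c).
Qed.

Definition partial_pw_coeffsE :=
  (partial_pw_coeffs_vertical, partial_l_pw_coeffs_ll, partial_r_pw_coeffs_ll,
   partial_r_pw_coeffs_lr, partial_r_pw_coeffs_rl, partial_pw_coeffs_l_lr,
   partial_pw_coeffs_l_r, partial_pw_coeffs_rr).

Lemma pw_coeffs_l_ll z C A B :
  pw_coeffs z (lshift n C) (lshift n A) (lshift n B) = G (lsubmx z) C A B.
Proof. by rewrite /pw_coeffs !split_lshift. Qed.

Lemma pw_coeffs_l_lr z C A B :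
  pw_coeffs z (lshift n C) (lshift n A) (rshift n B) = 0.
Proof. by rewrite /pw_coeffs !split_lshift split_rshift. Qed.

Lemma pw_coeffs_l_r z C A b : pw_coeffs z (lshift n C) (rshift n A) b = 0.
Proof. by rewrite /pw_coeffs split_lshift split_rshift. Qed.

Lemma pw_coeffs_r_lr z C A B :
  pw_coeffs z (rshift n C) (lshift n A) (rshift n B) = - G (lsubmx z) B A C.
Proof. by rewrite /pw_coeffs split_lshift !split_rshift. Qed.

Lemma pw_coeffs_r_rl z C A B :
  pw_coeffs z (rshift n C) (rshift n A) (lshift n B) = - G (lsubmx z) A B C.
Proof. by rewrite /pw_coeffs split_lshift !split_rshift. Qed.

Lemma pw_coeffs_rr z c A B : pw_coeffs z c (rshift n A) (rshift n B) = 0.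
Proof. by rewrite /pw_coeffs !split_rshift; case: (fintype.split c). Qed.

Definition pw_coeffsE :=
  (pw_coeffs_l_ll, pw_coeffs_l_lr, pw_coeffs_l_r, pw_coeffs_r_lr,
   pw_coeffs_r_rl, pw_coeffs_rr, mul0r, mulr0, subr0, sub0r, oppr0, addr0).

(** The traces of the coefficients vanish, so that only their divergence and
    the quadratic terms count.  The base part of the divergence is the
    derivative of G^C_AB along C; the fibre part, through
    [partial_pw_coeffs_vertical], supplies the other derivatives in Ric(G) and
    in its transpose, and the terms with a trace of [G].  The quadratic terms of
    base and fibre agree up to exchange of the two summation indices. *)
Lemma ricci_pw z : U (lsubmx z) ->
  ricci_metric pw_form z
  = pullback n (ricci G (lsubmx z) + (ricci G (lsubmx z))^T).
Proof.
move=> Uz; rewrite /ricci_metric.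
rewrite (ricci_eq_on (open_pullback (k := n) oU) Uz
  (fun y Uy c a b => levi_civita_pw c a b Uy)).
apply/matrixP => a b; rewrite -(splitK a) -(splitK b) mxE.
rewrite big_split_ord /= -big_split /=.
case: (fintype.split a) => A; case: (fintype.split b) => B /=.
- rewrite block_mxEul !mxE -big_split; apply: eq_bigr => C _ /=.
  rewrite !partial_pw_coeffsE partial_l_pw_coeffs_lr//.
  rewrite (partial_eq_on C oU Uz (fun y Uy => G_sym Uy C B A)).
  (* [S1] and [S2] are the quadratic terms of the base and of the fibre index
     [C], [S] comes from the fibre derivative, [S3] and [S4] belong to Ric(G) and
     its transpose; they match for each summation index separately *)
  set S := \sum_D _ * _; set S1 := bigop _ _ _; set S2 := bigop _ _ _.
  set S3 := bigop _ _ _; set S4 := bigop _ _ _.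
  have S12 : S1 + S2 = S3 + S4 - 2 * S.
    rewrite /S1 /S2 !big_split_ord /= /S /S3 /S4 mulr_sumr.
    rewrite -!big_split -sumrB; apply: eq_bigr => D _ /=.
    rewrite !pw_coeffsE (G_sym Uz C D C) (G_sym Uz C A D) (G_sym Uz D B A).
    by ring.
  rewrite addrACA S12; ring.
- rewrite block_mxEur mxE big1// => C _.
  rewrite !partial_pw_coeffsE !big_split_ord /=.
  by rewrite !big1 => [|D _|D _|D _|D _]; rewrite !pw_coeffsE.
- rewrite block_mxEdl mxE big1// => C _.
  rewrite !partial_pw_coeffsE !big_split_ord /=.
  by rewrite !big1 => [|D _|D _|D _|D _]; rewrite !pw_coeffsE.
- rewrite block_mxEdr mxE big1// => C _.
  rewrite !partial_pw_coeffsE !big_split_ord /=.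
  by rewrite !big1 => [|D _|D _|D _|D _]; rewrite !pw_coeffsE.
Qed.

End PattersonWalker.

Section ModifiedPattersonWalker.
Context {R : realType} {n : nat}.
Variables (G : coeffs R n) (Psi : 'rV[R]_n -> 'M[R]_n) (U : set 'rV[R]_n).
Hypothesis G_sym : forall x, U x -> forall c a b, G x c a b = G x c b a.

Lemma pw_formE z : U (lsubmx z) ->
  pw_metric G z + pullback n (Psi (lsubmx z)) = pw_form G Psi z.
Proof.
move=> Uz; pose S A B : R := \sum_K G (lsubmx z) K A B * rsubmx z 0 K.
have pick (F : 'I_n -> R) D : \sum_C (D == C)%:R * F C = F D.
  by rewrite -[RHS](sum_delta F); apply: eq_bigr => C _; rewrite mxE.
have none (F : 'I_n -> R) D : \sum_C (rshift n D == lshift n C)%:R * F C = 0.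
  by rewrite big1// => C _; rewrite eq_rlshift mul0r.
have pwE a b : pw_metric G z a b
    = (\sum_A (a == lshift n A)%:R * (b == rshift n A)%:R
       + \sum_A (b == lshift n A)%:R * (a == rshift n A)%:R)
      - (\sum_A (a == lshift n A)%:R * (\sum_B (b == lshift n B)%:R * S A B)
         + \sum_A (b == lshift n A)%:R * (\sum_B (a == lshift n B)%:R * S A B)).
  rewrite /pw_metric 2!mxE !summxE -!big_split; congr (_ + _) => /=.
    by apply: eq_bigr => A _; rewrite !mxE !big_ord1 !mxE /=; field.
  rewrite -!sumrN; apply: eq_bigr => A _; congr (- _).
  rewrite summxE !mulr_sumr -big_split; apply: eq_bigr => B _ /=.
  by rewrite !mxE !big_ord1 !mxE /= -/(S A B); field.
apply/matrixP => a b; rewrite mxE pullback_entry pwE -(splitK a) -(splitK b).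
case: (fintype.split a) => A; case: (fintype.split b) => B;
  rewrite ![unsplit _]/= ?split_lshift ?split_rshift.
- under eq_bigr do rewrite eq_lrshift mulr0.
  under [X in _ + X - _]eq_bigr do rewrite eq_lrshift mulr0.
  under [X in _ - (X + _)]eq_bigr do (rewrite eq_lshift;
    under eq_bigr do rewrite eq_lshift).
  under [X in _ - (_ + X)]eq_bigr do (rewrite eq_lshift;
    under eq_bigr do rewrite eq_lshift).
  rewrite !big1_eq !pick block_mxEul mxE -/(S A B).
  have -> : S B A = S A B by apply: eq_bigr => K _; rewrite G_sym.
  by ring.
- under eq_bigr do rewrite eq_lshift eq_rshift.
  under [X in _ - (X + _)]eq_bigr do rewrite none mulr0.
  by rewrite pick !none big1_eq block_mxEur mxE eq_sym !addr0 subr0.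
- under [X in _ + X - _]eq_bigr do rewrite eq_lshift eq_rshift.
  under [X in _ - (_ + X)]eq_bigr do rewrite none mulr0.
  by rewrite pick !none big1_eq block_mxEdl mxE !addr0 add0r subr0.
- by rewrite !none block_mxEdr mxE !addr0 subr0.
Qed.

End ModifiedPattersonWalker.

Section SchoutenPattersonWalker.
Context {R : realType} {n : nat}.
Variables (G : coeffs R n) (Psi : 'rV[R]_n -> 'M[R]_n) (U : set 'rV[R]_n).
Hypothesis oU : open U.
Hypothesis G_sym : forall x, U x -> forall c a b, G x c a b = G x c b a.
Hypothesis G_diff :
  forall x, U x -> forall c a b, differentiable (fun y => G y c a b) x.
Hypothesis Psi_diff :
  forall x, U x -> forall a b, differentiable (fun y => Psi y a b) x.

(** The Ricci tensor lives in the base-base block, where the inverse metric is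
    zero. *)
Lemma scalar_curvature_pw z : U (lsubmx z) ->
  scalar_curvature (pw_form G Psi) z = 0.
Proof.
move=> Uz; rewrite /scalar_curvature big1// => a _; rewrite big1// => b _.
rewrite invmx_pw_form (ricci_pw oU)// pullback_entry.
rewrite -{1}(splitK a) -{1}(splitK b).
case: (fintype.split a) => A; case: (fintype.split b) => B; rewrite ?mulr0//.
by rewrite block_mxEul mxE mul0r.
Qed.

Lemma schouten_pw z : U (lsubmx z) ->
  schouten (pw_form G Psi) z
  = pullback n (((n + n)%:R - 2)^-1
                *: (ricci G (lsubmx z) + (ricci G (lsubmx z))^T)).
Proof.
move=> Uz; rewrite /schouten scalar_curvature_pw// mul0r scale0r subr0.
by rewrite (ricci_pw oU)// /pullback scale_block_mx !scaler0.
Qed.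

End SchoutenPattersonWalker.

(** * Curvature of ambient metrics in normal form *)

Section AmbientIndices.
Context {R : realType} {m : nat}.
Implicit Type z : 'rV[R]_(m + 2).

Definition index_t : 'I_(m + 2) := rshift m ord0.
Definition index_rho : 'I_(m + 2) := rshift m ord_max.

Lemma ord2_ind (Q : 'I_2 -> Prop) : Q ord0 -> Q ord_max -> forall e, Q e.
Proof.
move=> Q0 Q1 [[|[|//]] lt2].
  by rewrite (_ : Ordinal _ = ord0)//; exact/val_inj.
by rewrite (_ : Ordinal _ = ord_max)//; exact/val_inj.
Qed.

Lemma ambient_index_ind (Q : 'I_(m + 2) -> Prop) :
  (forall i, Q (lshift 2 i)) -> Q index_t -> Q index_rho -> forall a, Q a.
Proof.
move=> Ql Qt Qrho a; rewrite -(splitK a); case: (fintype.split a) => //= e.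
by elim/ord2_ind: e.
Qed.

Lemma sum_ambient_index (F : 'I_(m + 2) -> R) :
  \sum_a F a = \sum_i F (lshift 2 i) + (F index_t + F index_rho).
Proof.
rewrite big_split_ord /= big_ord_recl big_ord1; congr (_ + (_ + F _)).
by apply/val_inj.
Qed.

Lemma coordE z :
  (coord_t z = rsubmx z 0 ord0) * (coord_rho z = rsubmx z 0 ord_max).
Proof. by rewrite !mxE. Qed.

Lemma coord_t_line_l s i z :
  coord_t (s *: delta_mx 0 (lshift 2 i) + z) = coord_t z.
Proof. by rewrite !coordE rsubmx_line_l. Qed.

Lemma coord_rho_line_l s i z :
  coord_rho (s *: delta_mx 0 (lshift 2 i) + z) = coord_rho z.
Proof. by rewrite !coordE rsubmx_line_l. Qed.

Lemma coord_t_line_t s z : coord_t (s *: delta_mx 0 index_t + z) = s + coord_t z.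
Proof. by rewrite !coordE rsubmx_line_r !mxE mulr1. Qed.

Lemma coord_rho_line_t s z :
  coord_rho (s *: delta_mx 0 index_t + z) = coord_rho z.
Proof. by rewrite !coordE rsubmx_line_r !mxE mulr0 add0r. Qed.

Lemma coord_t_line_rho s z :
  coord_t (s *: delta_mx 0 index_rho + z) = coord_t z.
Proof. by rewrite !coordE rsubmx_line_r !mxE mulr0 add0r. Qed.

Lemma coord_rho_line_rho s z :
  coord_rho (s *: delta_mx 0 index_rho + z) = s + coord_rho z.
Proof. by rewrite !coordE rsubmx_line_r !mxE mulr1. Qed.

(** The points are explicit arguments: as rewrite rules with open patterns these
    equations would be tried against every vector of the goal. *)
Definition lineE_l s i z :=
  (lsubmx_line_l s i z, coord_t_line_l s i z, coord_rho_line_l s i z).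
Definition lineE_t s z :=
  (lsubmx_line_r s ord0 z, coord_t_line_t s z, coord_rho_line_t s z).
Definition lineE_rho s z :=
  (lsubmx_line_r s ord_max z, coord_t_line_rho s z, coord_rho_line_rho s z).

End AmbientIndices.

Section NormalForm.
Context {R : realType} {m : nat}.
Variables g0 P : 'rV[R]_m -> 'M[R]_m.
Implicit Type z : 'rV[R]_(m + 2).

Definition slice (rho : R) (y : 'rV[R]_m) : 'M[R]_m := g0 y + (2 * rho) *: P y.

Definition fg_form z : 'M[R]_(m + 2) :=
  (2 * coord_rho z) *: odot (dt R m) (dt R m)
  + (2 * coord_t z) *: odot (dt R m) (drho R m)
  + coord_t z ^+ 2 *: pullback 2 (slice (coord_rho z) (lsubmx z)).

Definition endo (y : 'rV[R]_m) : 'M[R]_m := invmx (g0 y) *m P y.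

(** The known coefficients of a metric in normal form, specialised to slices
    h = g0 + 2 rho P with P g0^-1 P = 0: then h^-1 P = g0^-1 P, and the
    coefficient - h + rho h' (h' the derivative in rho) is - g0. *)
Definition fg_coeffs : coeffs R (m + 2) := fun z c a b =>
  let t := coord_t z in
  let y := lsubmx z in
  match fintype.split c, fintype.split a, fintype.split b with
  | inl k, inl i, inl j => levi_civita (slice (coord_rho z)) y k i j
  | inl k, inl i, inr e | inl k, inr e, inl i =>
      if val e is 0%N then (k == i)%:R / t else endo y k i
  | inr e, inl i, inl j =>
      if val e is 0%N then - (t * P y i j) else - g0 y i j
  | inr e, inr f, inr f' =>
      match val e, val f, val f' with
      | 1%N, 0%N, 1%N | 1%N, 1%N, 0%N => t^-1
      | _, _, _ => 0
      end
  | _, _, _ => 0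
  end.

Notation it := (@index_t m).
Notation irho := (@index_rho m).

Lemma fg_form_block z :
  fg_form z = block_mx (coord_t z ^+ 2 *: slice (coord_rho z) (lsubmx z)) 0 0
    (\matrix_(e, f) (if e == f then if e == ord0 then 2 * coord_rho z else 0
                     else coord_t z)).
Proof.
apply/matrixP => a b; rewrite /fg_form /odot /pullback.
rewrite -(splitK a) -(splitK b).
case: (fintype.split a) => i; case: (fintype.split b) => j /=;
  rewrite ?(block_mxEul, block_mxEur, block_mxEdl, block_mxEdr);
  rewrite !mxE !big_ord1 !mxE ?split_lshift ?split_rshift /=;
  rewrite ?row_mxEl ?row_mxEr ?eq_lrshift ?eq_rlshift ?eq_rshift ?mxE.
1-3: by rewrite ?mul0r ?mulr0 ?addr0 ?mulr0 ?add0r.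
by elim/ord2_ind: i; elim/ord2_ind: j; rewrite /=; field.
Qed.

(** In the names below, l stands for a slice index, r for one of the last two
    indices, and t and rho for these themselves. *)
Lemma fg_form_ll z i j : fg_form z (lshift 2 i) (lshift 2 j)
  = coord_t z ^+ 2 * slice (coord_rho z) (lsubmx z) i j.
Proof. by rewrite fg_form_block block_mxEul mxE. Qed.

Lemma fg_form_lr z i e : fg_form z (lshift 2 i) (rshift m e) = 0.
Proof. by rewrite fg_form_block block_mxEur mxE. Qed.

Lemma fg_form_rl z i e : fg_form z (rshift m e) (lshift 2 i) = 0.
Proof. by rewrite fg_form_block block_mxEdl mxE. Qed.

Lemma fg_form_tt z : fg_form z it it = 2 * coord_rho z.
Proof. by rewrite fg_form_block block_mxEdr mxE. Qed.

Lemma fg_form_trho z : fg_form z it irho = coord_t z.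
Proof. by rewrite fg_form_block block_mxEdr mxE. Qed.

Lemma fg_form_rhot z : fg_form z irho it = coord_t z.
Proof. by rewrite fg_form_block block_mxEdr mxE. Qed.

Lemma fg_form_rhorho z : fg_form z irho irho = 0.
Proof. by rewrite fg_form_block block_mxEdr mxE. Qed.

Lemma fg_form_unit z : coord_t z != 0 ->
  slice (coord_rho z) (lsubmx z) \in unitmx -> fg_form z \in unitmx.
Proof.
move=> t0 hu; rewrite fg_form_block.
set t := coord_t z; set h := slice _ _; set B := (X in block_mx _ _ _ X).
pose B' : 'M[R]_2 := \matrix_(e, f) (if e == f
  then if e == ord0 then 0 else - (2 * coord_rho z) / t ^+ 2 else t^-1).
have BB' : B *m B' = 1%:M.
  apply/matrixP => e f; rewrite !mxE big_ord_recl big_ord1 !mxE.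
  rewrite (_ : lift ord0 ord0 = ord_max); last exact/val_inj.
  by elim/ord2_ind: e; elim/ord2_ind: f; rewrite /= ?mxE /=; field.
have : block_mx (t ^+ 2 *: h) 0 0 B *m block_mx (t ^- 2 *: invmx h) 0 0 B' = 1%:M.
  rewrite mulmx_block !mulmx0 !mul0mx !addr0 !add0r BB' -scalemxAl -scalemxAr.
  by rewrite scalerA mulmxV// mulfV ?expf_neq0// scale1r -scalar_mx_block.
by move=> /mulmx1_unit[].
Qed.

Variable U : set 'rV[R]_m.
Hypothesis oU : open U.
Hypothesis g0_unit : forall y, U y -> g0 y \in unitmx.
Hypothesis g0_sym : forall y, U y -> forall i j, g0 y i j = g0 y j i.
Hypothesis P_sym : forall y, U y -> forall i j, P y i j = P y j i.
Hypothesis g0_diff :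
  forall y, U y -> forall i j, differentiable (fun x => g0 x i j) y.
Hypothesis P_diff :
  forall y, U y -> forall i j, differentiable (fun x => P x i j) y.
Hypothesis P_nilpotent : forall y, U y -> P y *m endo y = 0.

(** This is why raising an index of [P] gives the same endomorphism for all
    slices, and why all slices are nondegenerate. *)
Lemma slice_endo rho y : U y -> slice rho y *m endo y = P y.
Proof.
move=> Uy; rewrite mulmxDl -scalemxAl P_nilpotent// scaler0 addr0.
by rewrite mulKVmx// g0_unit.
Qed.

Lemma slice_unit rho y : U y -> slice rho y \in unitmx.
Proof.
move=> Uy; have gu := g0_unit Uy.
have : slice rho y *m ((1%:M - (2 * rho) *: endo y) *m invmx (g0 y)) = 1%:M.
  rewrite mulmxA mulmxBr mulmx1 -scalemxAr slice_endo// addrK.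
  by rewrite mulmxV.
by move=> /mulmx1_unit[].
Qed.

Lemma partial_l_fg_ll z k i j : U (lsubmx z) ->
  partial (lshift 2 k) (fun y => fg_form y (lshift 2 i) (lshift 2 j)) z
  = coord_t z ^+ 2
    * partial k (fun x => slice (coord_rho z) x i j) (lsubmx z).
Proof.
move=> Uz; rewrite [X in _ * X]/partial.
pose f x := slice (coord_rho z) x i j.
have df : differentiable f (lsubmx z).
  have -> : f = (fun x => g0 x i j) + (2 * coord_rho z) *: (fun x => P x i j).
    by apply: funext => x; rewrite /f !mxE.
  by apply: differentiableD; [exact: g0_diff|apply/differentiableZ/P_diff].
have dv : derivable f (lsubmx z) (delta_mx 0 k) by exact: diff_derivable.
rewrite -[RHS](deriveZ (coord_t z ^+ 2) dv).
apply: derive_same_line => s.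
by rewrite fg_form_ll !(lineE_l s k z).
Qed.

Lemma partial_t_fg_ll z i j :
  partial it (fun y => fg_form y (lshift 2 i) (lshift 2 j)) z
  = 2 * coord_t z * slice (coord_rho z) (lsubmx z) i j.
Proof.
apply: (@derive_quadratic _ _ _ _ _ _ (slice (coord_rho z) (lsubmx z) i j)) => s.
by rewrite !fg_form_ll !(lineE_t s z); ring.
Qed.

Lemma partial_rho_fg_ll z i j :
  partial irho (fun y => fg_form y (lshift 2 i) (lshift 2 j)) z
  = 2 * coord_t z ^+ 2 * P (lsubmx z) i j.
Proof.
apply: derive_affine => s.
by rewrite !fg_form_ll !(lineE_rho s z) !mxE; ring.
Qed.

Lemma partial_fg_lr z c i e :
  partial c (fun y => fg_form y (lshift 2 i) (rshift m e)) z = 0.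
Proof. by apply: derive_constant_along => s; rewrite !fg_form_lr. Qed.

Lemma partial_fg_rl z c i e :
  partial c (fun y => fg_form y (rshift m e) (lshift 2 i)) z = 0.
Proof. by apply: derive_constant_along => s; rewrite !fg_form_rl. Qed.

Lemma partial_fg_tt z :
  (forall k, partial (lshift 2 k) (fun y => fg_form y it it) z = 0) *
  (partial it (fun y => fg_form y it it) z = 0) *
  (partial irho (fun y => fg_form y it it) z = 2).
Proof.
split; [split=> [k|]|]; apply: derive_affine => s; rewrite !fg_form_tt.
- by rewrite (lineE_l s k z); ring.
- by rewrite (lineE_t s z); ring.
- by rewrite (lineE_rho s z); ring.
Qed.

Lemma partial_fg_trho z :
  (forall k, partial (lshift 2 k) (fun y => fg_form y it irho) z = 0) *
  (partial it (fun y => fg_form y it irho) z = 1) *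
  (partial irho (fun y => fg_form y it irho) z = 0).
Proof.
split; [split=> [k|]|]; apply: derive_affine => s; rewrite !fg_form_trho.
- by rewrite (lineE_l s k z); ring.
- by rewrite (lineE_t s z); ring.
- by rewrite (lineE_rho s z); ring.
Qed.

Lemma partial_fg_rhot z :
  (forall k, partial (lshift 2 k) (fun y => fg_form y irho it) z = 0) *
  (partial it (fun y => fg_form y irho it) z = 1) *
  (partial irho (fun y => fg_form y irho it) z = 0).
Proof.
split; [split=> [k|]|]; apply: derive_affine => s; rewrite !fg_form_rhot.
- by rewrite (lineE_l s k z); ring.
- by rewrite (lineE_t s z); ring.
- by rewrite (lineE_rho s z); ring.
Qed.

Lemma partial_fg_rhorho z c :
  partial c (fun y => fg_form y irho irho) z = 0.
Proof. by apply: derive_constant_along => s; rewrite !fg_form_rhorho. Qed.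

Lemma sum_fg_form_l z (F : 'I_(m + 2) -> R) i :
  \sum_c fg_form z (lshift 2 i) c * F c
  = coord_t z ^+ 2
    * \sum_k slice (coord_rho z) (lsubmx z) i k * F (lshift 2 k).
Proof.
rewrite sum_ambient_index !fg_form_lr !mul0r !addr0 mulr_sumr.
by apply: eq_bigr => k _; rewrite fg_form_ll mulrA.
Qed.

Lemma sum_fg_form_t z (F : 'I_(m + 2) -> R) :
  \sum_c fg_form z it c * F c = 2 * coord_rho z * F it + coord_t z * F irho.
Proof.
rewrite sum_ambient_index big1 => [|k _]; last by rewrite fg_form_rl mul0r.
by rewrite fg_form_tt fg_form_trho add0r.
Qed.

Lemma sum_fg_form_rho z (F : 'I_(m + 2) -> R) :
  \sum_c fg_form z irho c * F c = coord_t z * F it.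
Proof.
rewrite sum_ambient_index big1 => [|k _]; last by rewrite fg_form_rl mul0r.
by rewrite fg_form_rhot fg_form_rhorho add0r mul0r addr0.
Qed.

Lemma fg_coeffs_lll z k i j : fg_coeffs z (lshift 2 k) (lshift 2 i) (lshift 2 j)
  = levi_civita (slice (coord_rho z)) (lsubmx z) k i j.
Proof. by rewrite /fg_coeffs !split_lshift. Qed.

Lemma fg_coeffs_llt z k i :
  (fg_coeffs z (lshift 2 k) (lshift 2 i) it = (k == i)%:R / coord_t z) *
  (fg_coeffs z (lshift 2 k) it (lshift 2 i) = (k == i)%:R / coord_t z).
Proof. by rewrite /fg_coeffs !split_lshift !split_rshift. Qed.

Lemma fg_coeffs_llrho z k i :
  (fg_coeffs z (lshift 2 k) (lshift 2 i) irho = endo (lsubmx z) k i) *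
  (fg_coeffs z (lshift 2 k) irho (lshift 2 i) = endo (lsubmx z) k i).
Proof. by rewrite /fg_coeffs !split_lshift !split_rshift. Qed.

Lemma fg_coeffs_lrr z k e f :
  fg_coeffs z (lshift 2 k) (rshift m e) (rshift m f) = 0.
Proof. by rewrite /fg_coeffs !split_lshift !split_rshift. Qed.

Lemma fg_coeffs_rll z i j :
  (fg_coeffs z it (lshift 2 i) (lshift 2 j)
     = - (coord_t z * P (lsubmx z) i j)) *
  (fg_coeffs z irho (lshift 2 i) (lshift 2 j) = - g0 (lsubmx z) i j).
Proof. by rewrite /fg_coeffs !split_lshift !split_rshift. Qed.

Lemma fg_coeffs_rlr z i e f :
  (fg_coeffs z (rshift m e) (lshift 2 i) (rshift m f) = 0) *
  (fg_coeffs z (rshift m e) (rshift m f) (lshift 2 i) = 0).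
Proof. by rewrite /fg_coeffs !split_lshift !split_rshift. Qed.

Lemma fg_coeffs_trr z e f : fg_coeffs z it (rshift m e) (rshift m f) = 0.
Proof. by rewrite /fg_coeffs !split_rshift. Qed.

Lemma fg_coeffs_rhotrho z :
  (fg_coeffs z irho it irho = (coord_t z)^-1) *
  (fg_coeffs z irho irho it = (coord_t z)^-1).
Proof. by rewrite /fg_coeffs !split_rshift. Qed.

Lemma fg_coeffs_rhoee z e : fg_coeffs z irho (rshift m e) (rshift m e) = 0.
Proof. by rewrite /fg_coeffs !split_rshift; elim/ord2_ind: e. Qed.

Definition fg_coeffsE :=
  (fg_coeffs_lll, fg_coeffs_llt, fg_coeffs_llrho, fg_coeffs_lrr,
   fg_coeffs_rll, fg_coeffs_rlr, fg_coeffs_trr, fg_coeffs_rhotrho,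
   fg_coeffs_rhoee).

Lemma levi_civita_fg z c a b : U (lsubmx z) -> coord_t z != 0 ->
  levi_civita fg_form z c a b = fg_coeffs z c a b.
Proof.
move=> Uz t0; set y := lsubmx z in Uz *; set rho := coord_rho z.
have hs i j : slice rho y i j = slice rho y j i.
  by rewrite !mxE g0_sym// P_sym.
have hN i j : \sum_k slice rho y i k * endo y k j = P y i j.
  by rewrite -(slice_endo rho Uz) mxE.
have hd i j : \sum_k slice rho y i k * ((k == j)%:R / coord_t z)
    = slice rho y i j / coord_t z.
  rewrite (bigD1 j)//= eqxx mul1r big1 ?addr0// => k kj.
  by rewrite (negbTE kj) mul0r mulr0.
apply: (@levi_civita_unique _ _ _ _ (fun c => fg_coeffs z c a b)) => [|d].
  by apply: fg_form_unit => //; exact: slice_unit.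
move: d; apply: (@ambient_index_ind m) => [k||];
  move: a; apply: (@ambient_index_ind m) => [i||];
  move: b; apply: (@ambient_index_ind m) => [j||];
  rewrite ?sum_fg_form_l ?sum_fg_form_t ?sum_fg_form_rho;
  try under eq_bigr do rewrite !fg_coeffsE;
  rewrite -?/y -?/rho ?koszul ?hN ?hd ?fg_coeffsE;
  rewrite ?partial_l_fg_ll// ?partial_t_fg_ll ?partial_rho_fg_ll
    ?partial_fg_lr ?partial_fg_rl ?partial_fg_tt ?partial_fg_trho
    ?partial_fg_rhot ?partial_fg_rhorho -?/y -?/rho; try exact: slice_unit;
  rewrite ?(hs k) ?(P_sym Uz k) ?mxE ?(eq_bigr _ (fun k' _ => mulr0 _)) ?big1_eq;
  by field.
Qed.

(** Under these conditions the Ricci tensor vanishes.  The first two say that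
    the volume of the slices does not depend on [rho] and that [P] has trace
    zero; asking for each diagonal coefficient separately, which the coordinates
    (x, p) permit, avoids differentiating sums of functions that are not known
    to be differentiable.  The last two are the divergence-freeness of [P] and
    the equation Ric(h) = (m - 2) P for all slices [h]. *)
Hypothesis trace_slice : forall rho y, U y -> forall k j,
  levi_civita (slice rho) y k j k = levi_civita g0 y k j k.
Hypothesis endo_diag : forall y, U y -> forall k, endo y k k = 0.
Hypothesis endo_div : forall rho y, U y -> forall j,
  \sum_k (partial k (fun x => endo x k j) y
    + \sum_l (levi_civita (slice rho) y k k l * endo y l j
              - endo y k l * levi_civita (slice rho) y l j k)) = 0.
Hypothesis ricci_slice : forall rho y, U y ->
  ricci_metric (slice rho) y = (m%:R - 2) *: P y.

Lemma partial_l_fg_coeffs_lll z e k i j :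
  partial (lshift 2 e)
    (fun y => fg_coeffs y (lshift 2 k) (lshift 2 i) (lshift 2 j)) z
  = partial e (fun x => levi_civita (slice (coord_rho z)) x k i j) (lsubmx z).
Proof.
apply: derive_same_line => s.
by rewrite fg_coeffs_lll !(lineE_l s e z).
Qed.

Lemma partial_t_fg_coeffs_lll z k i j :
  partial it (fun y => fg_coeffs y (lshift 2 k) (lshift 2 i) (lshift 2 j)) z = 0.
Proof.
apply: derive_constant_along => s.
by rewrite !fg_coeffs_lll !(lineE_t s z).
Qed.

Lemma partial_rho_fg_coeffs_trace z k i : U (lsubmx z) ->
  partial irho
    (fun y => fg_coeffs y (lshift 2 k) (lshift 2 i) (lshift 2 k)) z = 0.
Proof.
move=> Uz; apply: derive_constant_along => s.
by rewrite !fg_coeffs_lll !(lineE_rho s z) !trace_slice.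
Qed.

Lemma partial_l_fg_coeffs_llt z e k i :
  (partial (lshift 2 e)
     (fun y => fg_coeffs y (lshift 2 k) (lshift 2 i) it) z = 0) *
  (partial (lshift 2 e)
     (fun y => fg_coeffs y (lshift 2 k) it (lshift 2 i)) z = 0).
Proof.
by split; apply: derive_constant_along => s;
  rewrite !fg_coeffs_llt (lineE_l s e z).
Qed.

Lemma partial_rho_fg_coeffs_llt z k i :
  partial irho (fun y => fg_coeffs y (lshift 2 k) it (lshift 2 i)) z = 0.
Proof.
by apply: derive_constant_along => s; rewrite !fg_coeffs_llt (lineE_rho s z).
Qed.

Lemma derive_coord_t_inv z : coord_t z != 0 ->
  partial it (fun y => (coord_t y)^-1) z = - (coord_t z) ^- 2.
Proof.
move=> t0; rewrite /partial deriveV//; last first.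
  by apply/diff_derivable/differentiable_coord.
by rewrite -/(partial _ _ _) partial_coordinate eqxx [LHS]mulr1.
Qed.

Lemma partial_t_fg_coeffs_llt z k : coord_t z != 0 ->
  partial it (fun y => fg_coeffs y (lshift 2 k) it (lshift 2 k)) z
  = - (coord_t z) ^- 2.
Proof.
move=> t0; rewrite -derive_coord_t_inv//; apply: derive_same_line => s.
by rewrite fg_coeffs_llt eqxx mul1r.
Qed.

Lemma partial_l_fg_coeffs_llrho z e k i :
  (partial (lshift 2 e)
     (fun y => fg_coeffs y (lshift 2 k) (lshift 2 i) irho) z
   = partial e (fun x => endo x k i) (lsubmx z)) *
  (partial (lshift 2 e)
     (fun y => fg_coeffs y (lshift 2 k) irho (lshift 2 i)) z
   = partial e (fun x => endo x k i) (lsubmx z)).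
Proof.
by split; apply: derive_same_line => s; rewrite fg_coeffs_llrho (lineE_l s e z).
Qed.

Lemma partial_r_fg_coeffs_lrhol z e k i :
  partial (rshift m e)
    (fun y => fg_coeffs y (lshift 2 k) irho (lshift 2 i)) z = 0.
Proof.
apply: derive_constant_along => s.
by rewrite !fg_coeffs_llrho lsubmx_line_r.
Qed.

Lemma partial_fg_coeffs_lrr z c k e f :
  partial c (fun y => fg_coeffs y (lshift 2 k) (rshift m e) (rshift m f)) z = 0.
Proof. by apply: derive_constant_along => s; rewrite !fg_coeffs_lrr. Qed.

Lemma partial_t_fg_coeffs_tll z i j :
  partial it (fun y => fg_coeffs y it (lshift 2 i) (lshift 2 j)) z
  = - P (lsubmx z) i j.
Proof.
apply: derive_affine => s.
by rewrite !fg_coeffs_rll !(lineE_t s z); ring.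
Qed.

Lemma partial_rho_fg_coeffs_rholl z i j :
  partial irho (fun y => fg_coeffs y irho (lshift 2 i) (lshift 2 j)) z = 0.
Proof.
by apply: derive_constant_along => s; rewrite !fg_coeffs_rll (lineE_rho s z).
Qed.

Lemma partial_fg_coeffs_rlr z c e i f :
  (partial c
     (fun y => fg_coeffs y (rshift m e) (lshift 2 i) (rshift m f)) z = 0) *
  (partial c
     (fun y => fg_coeffs y (rshift m e) (rshift m f) (lshift 2 i)) z = 0).
Proof. by split; apply: derive_constant_along => s; rewrite !fg_coeffs_rlr. Qed.

Lemma partial_fg_coeffs_trr z c e f :
  partial c (fun y => fg_coeffs y it (rshift m e) (rshift m f)) z = 0.
Proof. by apply: derive_constant_along => s; rewrite !fg_coeffs_trr. Qed.

Lemma partial_fg_coeffs_rhoee z c e :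
  partial c (fun y => fg_coeffs y irho (rshift m e) (rshift m e)) z = 0.
Proof. by apply: derive_constant_along => s; rewrite !fg_coeffs_rhoee. Qed.

Lemma partial_l_fg_coeffs_rhotrho z k :
  partial (lshift 2 k) (fun y => fg_coeffs y irho it irho) z = 0.
Proof.
by apply: derive_constant_along => s; rewrite !fg_coeffs_rhotrho (lineE_l s k z).
Qed.

Lemma partial_rho_fg_coeffs_rhotrho z :
  (partial irho (fun y => fg_coeffs y irho it irho) z = 0) *
  (partial irho (fun y => fg_coeffs y irho irho it) z = 0).
Proof.
by split; apply: derive_constant_along => s;
  rewrite !fg_coeffs_rhotrho (lineE_rho s z).
Qed.

Lemma partial_t_fg_coeffs_rhotrho z : coord_t z != 0 ->
  partial it (fun y => fg_coeffs y irho it irho) z = - (coord_t z) ^- 2.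
Proof.
move=> t0; rewrite -derive_coord_t_inv//; apply: derive_same_line => s.
by rewrite fg_coeffs_rhotrho.
Qed.

Definition partial_fg_coeffsE :=
  (partial_l_fg_coeffs_lll, partial_t_fg_coeffs_lll,
   partial_rho_fg_coeffs_trace,
   partial_l_fg_coeffs_llt, partial_rho_fg_coeffs_llt, partial_t_fg_coeffs_llt,
   partial_l_fg_coeffs_llrho, partial_r_fg_coeffs_lrhol, partial_fg_coeffs_lrr,
   partial_t_fg_coeffs_tll, partial_rho_fg_coeffs_rholl,
   partial_fg_coeffs_rlr, partial_fg_coeffs_trr, partial_fg_coeffs_rhoee,
   partial_l_fg_coeffs_rhotrho, partial_rho_fg_coeffs_rhotrho,
   partial_t_fg_coeffs_rhotrho).

Let simp0 := (mul0r, mulr0, subr0, sub0r, oppr0, addr0, add0r).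

Lemma sum_kronecker (F : 'I_m -> R) (t : R) i :
  (\sum_k F k * ((k == i)%:R / t) = F i / t) *
  (\sum_k (i == k)%:R / t * F k = F i / t) *
  (\sum_k (k == i)%:R / t * F k = F i / t).
Proof.
have pick (e : 'I_m -> R) : e i = t^-1 -> (forall k, k != i -> e k = 0) ->
    \sum_k F k * e k = F i / t.
  move=> ei ek; rewrite (bigD1 i)//= ei big1 ?addr0// => k /ek ->.
  exact: mulr0.
split; [split|].
- by apply: pick => [|k /negPf ->]; rewrite ?eqxx ?mul1r ?mul0r.
- under eq_bigr do rewrite mulrC.
  apply: pick => [|k]; rewrite ?eqxx ?mul1r// eq_sym => /negPf ->.
  by rewrite mul0r.
- under eq_bigr do rewrite mulrC.
  by apply: pick => [|k /negPf ->]; rewrite ?eqxx ?mul1r ?mul0r.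
Qed.

Lemma levi_civita_slice_sym rho y k i j : U y ->
  levi_civita (slice rho) y k i j = levi_civita (slice rho) y k j i.
Proof.
move=> Uy; rewrite /levi_civita; congr (_ * _); apply: eq_bigr => d _.
congr (_ * (_ - _)); first by rewrite addrC.
by apply: (partial_eq_on _ oU Uy) => x Ux; rewrite !mxE g0_sym// P_sym.
Qed.

(** The nonzero contributions are Ric(h) - (m - 2) P along two slice
    directions, the divergence of [P] in the mixed components with [rho], and
    minus the trace of the square of [endo] along [rho] twice; the components
    with [t] cancel by homogeneity and because [P] has trace zero. *)
Lemma ricci_fg z : U (lsubmx z) -> 0 < coord_t z -> ricci_metric fg_form z = 0.
Proof.
move=> Uz tpos; rewrite /ricci_metric.
have t0 : coord_t z != 0 by rewrite gt_eqF.
pose V := [set y : 'rV[R]_(m + 2) | U (lsubmx y)] `&` [set y | 0 < coord_t y].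
have oV : open V.
  apply: openI; first exact: open_pullback.
  apply: (@open_comp _ _ (@coord_t R m) [set t | 0 < t]); last exact: open_gt.
  by move=> y _; exact: coord_continuous.
rewrite (ricci_eq_on (G' := fg_coeffs) oV)//; last first.
  by move=> y [Uy ty] c a b; rewrite levi_civita_fg// gt_eqF.
set y := lsubmx z in Uz *; set rho := coord_rho z.
apply/matrixP => a b; rewrite mxE [RHS]mxE sum_ambient_index.
move: a; apply: (@ambient_index_ind m) => [i||];
  move: b; apply: (@ambient_index_ind m) => [j||];
  rewrite ?partial_fg_coeffsE// !sum_ambient_index;
  under [\sum_i (fg_coeffs z it _ _ * _ - _)]eq_bigr
    do rewrite ?fg_coeffsE ?simp0;
  under [\sum_i (fg_coeffs z irho _ _ * _ - _)]eq_bigr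
    do rewrite ?fg_coeffsE ?simp0;
  under [X in X + _]eq_bigr do (
    rewrite ?partial_fg_coeffsE// !sum_ambient_index;
    under eq_bigr do rewrite !fg_coeffsE ?simp0;
    rewrite ?fg_coeffsE ?(endo_diag Uz) ?simp0);
  rewrite ?fg_coeffsE ?simp0 -/y -/rho ?big1_eq ?simp0//.
- set t := coord_t z in t0 *.
  (* the terms besides Ric(h) add up to - (m - 2) P: the trace of the
     coefficients delta / t gives - m P, the others 2 P *)
  pose L := levi_civita (slice rho).
  pose F k := partial k (fun x => L x k i j) y - partial j (fun x => L x k i k) y
    + \sum_l (L y k k l * L y l i j - L y k j l * L y l i k).
  have ricciE : \sum_k F k = (m%:R - 2) * P y i j.
    have := congr1 (fun A : 'M[R]_m => A i j) (ricci_slice rho Uz).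
    by rewrite !mxE.
  have g0N (i' j' : 'I_m) : \sum_k g0 y i' k * endo y k j' = P y i' j'.
    by rewrite -[P y]mul1mx -(mulmxV (g0_unit Uz)) -mulmxA mxE.
  rewrite (eq_bigr (fun k => F k + (- P y i j + ((k == j)%:R / t * (t * P y i k)
      + g0 y i k * endo y k j)))) => [|k _]; last first.
    by rewrite addrA eqxx mulr1n; congr (_ + _); field.
  clearbody F; rewrite !big_split /= ricciE sumr_const card_ord.
  rewrite !sum_kronecker g0N.
  have -> : \sum_k - (- (t * P y j k) * ((k == i)%:R / t)) = P y j i.
    transitivity (t * P y j i / t); last by field.
    rewrite -[RHS](sum_kronecker (fun k => t * P y j k)).
    by apply: eq_bigr => k _; rewrite mulNr opprK.
  have -> : \sum_k - (- g0 y j k * endo y k i) = P y j i.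
    by rewrite -g0N; apply: eq_bigr => k _; rewrite mulNr opprK.
  by rewrite (P_sym Uz j i) -mulr_natl; field.
- rewrite big1// => k _; rewrite sumrB !sum_kronecker.
  by rewrite levi_civita_slice_sym// subrr.
- exact: endo_div.
- rewrite big1// => k _; rewrite sumrB !sum_kronecker.
  by rewrite levi_civita_slice_sym// subrr.
- rewrite big1 => [|k _]; last first.
    by rewrite sumrN sum_kronecker eqxx mulr1n; field.
  by field.
- by rewrite big1// => k _; rewrite sumrN sum_kronecker endo_diag// mul0r oppr0.
- rewrite -[RHS](endo_div rho Uz j) !big_split /=; congr (_ + _).
    rewrite -[RHS]addr0; congr (_ + _); rewrite big1// => k _.
    rewrite (partial_eq_on j oU Uz (fun x Ux => endo_diag Ux k)).
    by rewrite [partial _ _ _]derive_cst oppr0.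
  under eq_bigr do rewrite sumrB; under [RHS]eq_bigr do rewrite sumrB.
  rewrite !sumrB; congr (_ - _); rewrite exchange_big /=.
  by apply: eq_bigr => k _; apply: eq_bigr => l _; rewrite mulrC.
- by rewrite big1// => k _; rewrite sumrN sum_kronecker endo_diag// mul0r oppr0.
- rewrite big1// => k _; rewrite sumrN.
  have -> : \sum_l endo y k l * endo y l k = (endo y *m endo y) k k.
    by rewrite [RHS]mxE.
  by rewrite {1}/endo -mulmxA P_nilpotent// mulmx0 mxE oppr0.
Qed.

End NormalForm.

(** * The ambient metric of a Patterson-Walker metric *)

Section AmbientPattersonWalker.
Context {R : realType} {n : nat}.
Variables (G : coeffs R n) (Psi Q : 'rV[R]_n -> 'M[R]_n) (U : set 'rV[R]_n).
Hypothesis oU : open U.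
Hypothesis G_sym : forall x, U x -> forall c a b, G x c a b = G x c b a.
Hypothesis G_diff :
  forall x, U x -> forall c a b, differentiable (fun y => G y c a b) x.
Hypothesis Psi_sym : forall x, U x -> forall a b, Psi x a b = Psi x b a.
Hypothesis Psi_diff :
  forall x, U x -> forall a b, differentiable (fun y => Psi y a b) x.
Hypothesis Q_sym : forall x, U x -> forall a b, Q x a b = Q x b a.
Hypothesis Q_diff :
  forall x, U x -> forall a b, differentiable (fun y => Q y a b) x.
Hypothesis Q_ricci : forall x, U x ->
  ricci G x + (ricci G x)^T = ((n + n)%:R - 2) *: Q x.

Local Notation g0 := (pw_form G Psi).
Local Notation P := (fun y : 'rV[R]_(n + n) => pullback n (Q (lsubmx y))).

(** Moving along [rho] only changes [Psi], which the Ricci tensor does not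
    see. *)
Lemma slice_pw rho :
  slice g0 P rho = pw_form G (fun x => Psi x + (2 * rho) *: Q x).
Proof.
apply: funext => y; rewrite /slice /pw_form /pullback scale_block_mx !scaler0.
rewrite add_block_mx !addr0; congr (block_mx _ _ _ _).
by apply/matrixP => A B; rewrite !mxE addrA.
Qed.

(** The image is vertical, the kernel contains the vertical vectors, and the
    entries depend on the base point only: with the zeros of [pw_coeffs], the
    square, the diagonal and the divergence of this endomorphism vanish. *)
Lemma endo_pw y : endo g0 P y = block_mx 0 0 (Q (lsubmx y)) 0.
Proof.
rewrite /endo invmx_pw_form /pullback mulmx_block.
by rewrite !mul0mx !mulmx0 !mul1mx !addr0.
Qed.

Lemma differentiable_pw_form y a b : U (lsubmx y) ->
  differentiable (fun z => g0 z a b) y.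
Proof.
move=> Uy; rewrite -(splitK a) -(splitK b).
case: (fintype.split a) => A; case: (fintype.split b) => B /=.
- have -> : (fun z => g0 z (lshift n A) (lshift n B))
      = (- 2 *: \sum_K ((fun z => G (lsubmx z) K A B)
                       * (fun z => z 0 (rshift n K))))
        + (fun z => Psi (lsubmx z) A B).
    apply: funext => z; rewrite block_mxEul mxE.
    rewrite [RHS]/(_ + _) /= [X in _ = X + _]/(_ *: _) /= fct_sumE.
    by congr (_ * _ + _); apply: eq_bigr => K _; rewrite mxE.
  apply: differentiableD; last first.
    apply: (@differentiable_pullback _ _ _ (fun x => Psi x A B)).
    exact: Psi_diff.
  apply/differentiableZ/differentiable_sum => K.
  apply: differentiableM; last exact: differentiable_coord.
  by apply: (@differentiable_pullback _ _ _ (fun x => G x K A B)); exact: G_diff.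
- rewrite (_ : (fun z => _) = cst ((1%:M : 'M[R]_n) A B)); first
    exact: differentiable_cst.
  by apply: funext => z; rewrite block_mxEur.
- rewrite (_ : (fun z => _) = cst ((1%:M : 'M[R]_n) A B)); first
    exact: differentiable_cst.
  by apply: funext => z; rewrite block_mxEdl.
- rewrite (_ : (fun z => _) = cst ((0 : 'M[R]_n) A B)); first
    exact: differentiable_cst.
  by apply: funext => z; rewrite block_mxEdr.
Qed.

Lemma pw_form_sym y a b : U (lsubmx y) -> g0 y a b = g0 y b a.
Proof.
move=> Uy; rewrite -(splitK a) -(splitK b).
case: (fintype.split a) => A; case: (fintype.split b) => B /=.
- rewrite !block_mxEul; exact: (pw_base_block_sym G_sym Psi_sym).
- by rewrite block_mxEur block_mxEdl !mxE eq_sym.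
- by rewrite block_mxEur block_mxEdl !mxE eq_sym.
- by rewrite !block_mxEdr !mxE.
Qed.

Lemma ricci_ambient_pw z : U (lsubmx (lsubmx z)) -> 0 < coord_t z ->
  ricci_metric (fg_form g0 P) z = 0.
Proof.
pose V := [set y : 'rV[R]_(n + n) | U (lsubmx y)].
have oV : open V by exact: open_pullback.
have Psi2_sym rho x : U x -> forall a b,
    (Psi x + (2 * rho) *: Q x) a b = (Psi x + (2 * rho) *: Q x) b a.
  by move=> Ux a b; rewrite !mxE Psi_sym// Q_sym.
have Psi2_diff rho x : U x -> forall a b,
    differentiable (fun y => (Psi y + (2 * rho) *: Q y) a b) x.
  move=> Ux a b; rewrite (_ : (fun y => _)
      = (fun y => Psi y a b) + (2 * rho) *: (fun y => Q y a b)).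
    by apply: differentiableD; [exact: Psi_diff|apply/differentiableZ/Q_diff].
  by apply: funext => y; rewrite !mxE.
have LC rho y c a b : V y -> levi_civita (slice g0 P rho) y c a b
    = pw_coeffs G (fun x => Psi x + (2 * rho) *: Q x) y c a b.
  by move=> Vy; rewrite slice_pw; exact: (levi_civita_pw G_diff (Psi2_diff rho)).
move=> Uz tpos; apply: (@ricci_fg _ _ _ _ V) => //.
- by move=> y _; exact: pw_form_unit.
- by move=> y Vy i j; exact: pw_form_sym.
- move=> y Vy i j; rewrite !pullback_entry.
  by case: (fintype.split i) => A; case: (fintype.split j) => B //; exact: Q_sym.
- by move=> y Vy i j; exact: differentiable_pw_form.
- move=> y Vy i j.
  under [X in differentiable X _]funext do rewrite pullback_entry.
  case: (fintype.split i) => A; case: (fintype.split j) => B;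
    try exact: differentiable_cst.
  by apply: (@differentiable_pullback _ _ _ (fun x => Q x A B)); exact: Q_diff.
- move=> y Vy; rewrite endo_pw /pullback mulmx_block.
  by rewrite !mul0mx !mulmx0 !addr0 -block_mx0.
- move=> rho y Vy k j; rewrite LC// (levi_civita_pw G_diff Psi_diff)//.
  rewrite -(splitK k) -(splitK j).
  by case: (fintype.split k) => K; case: (fintype.split j) => J /=;
    rewrite !pw_coeffsE.
- move=> y Vy k; rewrite endo_pw -(splitK k).
  by case: (fintype.split k) => K; rewrite ?block_mxEul ?block_mxEdr mxE.
- move=> rho y Vy j; rewrite big1// => k _.
  rewrite (_ : partial k _ y = 0) ?add0r; last first.
    rewrite -(splitK k) -(splitK j); case: (fintype.split k) => K;
      case: (fintype.split j) => J /=;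
      apply: derive_constant_along => s; rewrite !endo_pw;
      rewrite ?(block_mxEul, block_mxEur, block_mxEdl, block_mxEdr) ?mxE//.
    by rewrite lsubmx_line_r.
  rewrite big1// => l _; rewrite !LC// endo_pw.
  rewrite -(splitK k) -(splitK l) -(splitK j).
  case: (fintype.split k) => K; case: (fintype.split l) => L;
    case: (fintype.split j) => J /=;
    rewrite ?(block_mxEul, block_mxEur, block_mxEdl, block_mxEdr) ?mxE;
    by rewrite !pw_coeffsE.
- move=> rho y Vy; rewrite slice_pw (ricci_pw oU G_sym G_diff (Psi2_diff rho))//.
  by rewrite Q_ricci// /pullback scale_block_mx !scaler0.
Qed.

End AmbientPattersonWalker.

(** * Change of charts *)

Section AmbientTensor.
Context {R : realType} {m : nat} (C : charts R m).
Hypothesis cdom_open : forall i : cindex C, open (cdom i).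
Hypothesis trans_diff : forall (i j : cindex C) x,
  overlap i j x -> differentiable (trans i j) x.

Lemma jacobian_ambient (i j : cindex C) (z : 'rV[R]_(m + 2)) :
  overlap i j (lsubmx z) ->
  'J (@trans R (m + 2) (ambient C) i j) z
  = block_mx ('J (trans i j) (lsubmx z)) 0 0 1%:M.
Proof.
move=> ov; have dt := trans_diff ov.
have dtb b : differentiable (fun y => trans i j y 0 b) (lsubmx z).
  apply: (@differentiable_comp _ _ _ _ (trans i j) (fun v => v 0 b)) => //.
  exact: differentiable_coord.
have transl b : (fun y => @trans R (m + 2) (ambient C) i j y 0 (lshift 2 b))
    = (fun y => trans i j (lsubmx y) 0 b).
  by apply: funext => y /=; rewrite row_mxEl.
have transr b : (fun y => @trans R (m + 2) (ambient C) i j y 0 (rshift m b))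
    = (fun y => y 0 (rshift m b)).
  by apply: funext => y /=; rewrite row_mxEr mxE.
have dT : differentiable (@trans R (m + 2) (ambient C) i j) z.
  apply: differentiable_row => b; rewrite -(splitK b).
  case: (fintype.split b) => e; rewrite [unsplit _]/= ?transl ?transr.
    by apply: (@differentiable_pullback _ _ _ (fun y => trans i j y 0 e)).
  exact: differentiable_coord.
apply/matrixP => a b; rewrite jacobian_entry// -(splitK a) -(splitK b).
case: (fintype.split a) => e; case: (fintype.split b) => f;
  rewrite ![unsplit _]/= ?transl ?transr.
- rewrite block_mxEul jacobian_entry//.
  by apply: derive_same_line => s; rewrite lsubmx_line_l.
- rewrite block_mxEur mxE partial_coordinate.
  by rewrite eq_lrshift.
- by rewrite block_mxEdl mxE (partial_r_pullback (fun y => trans i j y 0 f)).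
- by rewrite block_mxEdr mxE partial_coordinate eq_rshift.
Qed.

Variables g P : field2 C.
Hypothesis g_tensor : sym_tensor g.
Hypothesis P_tensor : sym_tensor P.

Lemma sym_tensor_slice rho : sym_tensor (fun i => slice (g i) (P i) rho).
Proof.
have [gs gsym gt] := g_tensor; have [Ps Psym Pt] := P_tensor; split.
- move=> i a b.
  apply: (@eq_smooth_on _ _ _ (fun x => g i x a b + 2 * rho * P i x a b)) => //.
    by move=> x _; rewrite !mxE.
  apply: smooth_onD => //; apply: smooth_onM => //; exact: smooth_on_cst.
- by move=> i x xi; rewrite /slice linearD linearZ /= gsym// Psym.
- move=> i j x xij; rewrite /slice (gt i j x xij) (Pt i j x xij).
  by rewrite mulmxDr mulmxDl -scalemxAr -scalemxAl.
Qed.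

Lemma smooth_slice_family (i : cindex C) a b :
  smooth_on [set w : 'rV[R]_(m + 1) | cdom i (lsubmx w)]
    (fun w => slice (g i) (P i) (w 0 (rshift m ord0)) (lsubmx w) a b).
Proof.
have [gs _ _] := g_tensor; have [Ps _ _] := P_tensor.
have oV : open [set w : 'rV[R]_(m + 1) | cdom i (lsubmx w)].
  exact: open_pullback.
apply: (@eq_smooth_on _ _ _ (fun w => g i (lsubmx w) a b
    + 2 * w 0 (rshift m ord0) * P i (lsubmx w) a b)) => //.
  by move=> x _; rewrite !mxE.
apply: smooth_onD => //; first exact: smooth_on_pullback (gs i a b).
apply: smooth_onM => //; last exact: smooth_on_pullback (Ps i a b).
by apply: smooth_onM => //; [exact: smooth_on_cst|exact: smooth_on_coord].
Qed.

Lemma open_ambient_cdom (i : cindex C) : open (@cdom R (m + 2) (ambient C) i).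
Proof.
apply: openI; first exact: open_pullback.
apply: (@open_comp _ _ (@coord_t R m) [set t | 0 < t]); last exact: open_gt.
by move=> y _; exact: coord_continuous.
Qed.

(** A change of charts leaves t and rho alone and acts on the slice directions
    as it does for [g] and [P]. *)
Lemma sym_tensor_fg_form : @sym_tensor R (m + 2) (ambient C)
  (fun i => fg_form (g i) (P i)).
Proof.
have [gs gsym gt] := g_tensor; have [Ps Psym Pt] := P_tensor; split.
- move=> i a b; set V := cdom _.
  have oV : open V by exact: open_ambient_cdom.
  have Vl : V `<=` [set z | @cdom R m C i (lsubmx z)] by move=> z [].
  rewrite -(splitK a) -(splitK b).
  case: (fintype.split a) => e; case: (fintype.split b) => f;
    rewrite ![unsplit _]/=.
  + apply: (@eq_smooth_on _ _ _ (fun z => coord_t z * coord_t z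
        * (g i (lsubmx z) e f + 2 * coord_rho z * P i (lsubmx z) e f))) => //.
      by move=> z _; rewrite fg_form_ll !mxE.
    apply: smooth_onM => //.
      by apply: smooth_onM => //; exact: smooth_on_coord.
    apply: smooth_onD => //; first
      exact: sub_smooth_on Vl (smooth_on_pullback (gs i e f)).
    apply: smooth_onM => //; last
      exact: sub_smooth_on Vl (smooth_on_pullback (Ps i e f)).
    by apply: smooth_onM => //; [exact: smooth_on_cst|exact: smooth_on_coord].
  + apply: (@eq_smooth_on _ _ _ (fun=> 0)) => //; last exact: smooth_on_cst.
    by move=> z _; rewrite fg_form_lr.
  + apply: (@eq_smooth_on _ _ _ (fun=> 0)) => //; last exact: smooth_on_cst.
    by move=> z _; rewrite fg_form_rl.
  + apply: (@eq_smooth_on _ _ _ (fun z => if e == f then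
        if e == ord0 then 2 * coord_rho z else 0 else coord_t z)) => //.
      by move=> z _; rewrite fg_form_block block_mxEdr mxE.
    case: (e == f); last exact: smooth_on_coord.
    case: (e == ord0); last exact: smooth_on_cst.
    by apply: smooth_onM => //; [exact: smooth_on_cst|exact: smooth_on_coord].
- move=> i z [zi _]; rewrite fg_form_block tr_block_mx !trmx0 linearZ /=.
  have [_ /(_ i _ zi) -> _] := sym_tensor_slice (coord_rho z).
  congr block_mx; apply/matrixP => e f; rewrite !mxE eq_sym.
  by case: eqVneq => [->|].
- move=> i j z [ov _]; rewrite jacobian_ambient//.
  rewrite !fg_form_block /coord_t /coord_rho /= !row_mxEr row_mxKl !mxE.
  have [_ _ /(_ i j _ ov) ->] := sym_tensor_slice (z 0 (rshift m ord_max)).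
  rewrite mulmx_block tr_block_mx mulmx_block !trmx0 trmx1.
  rewrite !(mulmx0, mul0mx, mulmx1, mul1mx, addr0, add0r).
  by rewrite -scalemxAr -scalemxAl.
Qed.

Lemma metric_fg_form :
  (forall i y rho, cdom i y -> slice (g i) (P i) rho y \in unitmx) ->
  @metric R (m + 2) (ambient C) (fun i => fg_form (g i) (P i)).
Proof.
move=> hu; split; first exact: sym_tensor_fg_form.
move=> i z [zi tpos]; apply: fg_form_unit; first by rewrite gt_eqF.
exact: hu.
Qed.

End AmbientTensor.

Section CotangentCharts.
Context {R : realType} {n : nat} (C : charts R n).
Hypothesis overlap_open : forall i j : cindex C, open (overlap i j).
Hypothesis trans_overlap : forall (i j : cindex C) x,
  overlap i j x -> overlap j i (trans i j x).
Hypothesis trans_smooth : forall (i j : cindex C) a,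
  smooth_on (overlap i j) (fun x => trans i j x 0 a).

Lemma differentiable_trans (i j : cindex C) x :
  overlap i j x -> differentiable (trans i j) x.
Proof.
move=> ov; apply: differentiable_row => b.
by apply: (@smooth_on_differentiable _ _ (overlap i j)).
Qed.

(** The Jacobian in the transformation law of the ambient metric is only
    meaningful where the change of charts is differentiable.  On the fibre this
    asks for the second derivatives of the inverse change of charts. *)
Lemma differentiable_cotangent_trans (i j : cindex C) (z : 'rV[R]_(n + n)) :
  overlap i j (lsubmx z) ->
  differentiable (@trans R (n + n) (cotangent C) i j) z.
Proof.
move=> ov; apply: differentiable_row => b; rewrite -(splitK b).
case: (fintype.split b) => B; rewrite [unsplit _]/=.
  rewrite (_ : (fun y => _) = (fun y => trans i j (lsubmx y) 0 B)).
    apply: (@differentiable_pullback _ _ _ (fun y => trans i j y 0 B)).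
    by apply: (@smooth_on_differentiable _ _ (overlap i j)).
  by apply: funext => y /=; rewrite row_mxEl.
pose F (y : 'rV[R]_(n + n)) A :=
  partial B (fun x => trans j i x 0 A) (trans i j (lsubmx y)).
have dF : differentiable
    (\sum_A ((fun y : 'rV[R]_(n + n) => y 0 (rshift n A)) * (F ^~ A))) z.
  apply: differentiable_sum => A; apply: differentiableM.
    exact: differentiable_coord.
  apply: (@differentiable_pullback _ _ _
    (fun x => partial B (fun x => trans j i x 0 A) (trans i j x))).
  apply: (@differentiable_comp _ _ _ _ (trans i j)).
    exact: differentiable_trans.
  apply: (@smooth_on_differentiable _ _ (overlap j i)); last exact: trans_overlap.
  exact/smooth_on_partial/trans_smooth.
apply: (differentiable_near_eq _ dF).
have nV : nbhs z [set y | overlap i j (lsubmx y)].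
  by apply: open_nbhs_nbhs; split=> //; exact/open_pullback/overlap_open.
apply: filterS nV => y yV /=; rewrite row_mxEr mxE fct_sumE.
apply: eq_bigr => A _; rewrite [LHS]/(_ * _) /=; congr (_ * _).
  by rewrite [RHS]mxE.
rewrite [RHS]mxE jacobian_entry//; exact/differentiable_trans/trans_overlap.
Qed.

End CotangentCharts.

Section ManifoldCharts.
Context {R : realType} {n : nat} (M : manifold R n).
Local Notation C := (local_charts M).

Lemma local_overlap_open (i j : cindex C) : open (overlap i j).
Proof.
rewrite openE => _ [q [qi qj] <-]; rewrite /interior /=.
have imo := @chart_img_open _ _ M i.
have cq : (chart i @` chart_dom i) (chart i q) by exists q.
have cont : {for chart i q, continuous (chart_inv i : 'rV[R]_n -> M)}.
  have := @chart_inv_continuous _ _ M i.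
  by rewrite continuous_open_subspace// => /(_ _ (mem_set cq)).
have nj : nbhs (chart i q) (chart_inv i @^-1` chart_dom j).
  apply: cont; rewrite chartK//.
  by apply: open_nbhs_nbhs; split => //; exact: chart_dom_open.
have ni : nbhs (chart i q) (chart i @` chart_dom i) by exact: open_nbhs_nbhs.
apply: filterS2 ni nj => y [q' q'i <-] /=; rewrite chartK// => q'j.
by exists q'.
Qed.

Lemma local_trans_overlap (i j : cindex C) x :
  overlap i j x -> overlap j i (trans i j x).
Proof. by move=> [q [qi qj] <-] /=; rewrite chartK//; exists q. Qed.

Lemma local_trans_smooth (i j : cindex C) a :
  smooth_on (overlap i j) (fun x => trans i j x 0 a).
Proof. exact: chart_smooth. Qed.

End ManifoldCharts.

(** * Global Ricci-flatness *)

Theorem theoremD (R : realType) (n : nat) (hn : (2 <= n)%N)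
  (M : manifold R n)
  (D : cindex (local_charts M) -> coeffs R n)
  (vol : cindex (local_charts M) -> 'rV[R]_n -> R)
  (Phi : field2 (local_charts M))
  (gbar Pbar : field2 (cotangent (local_charts M)))
  (hM : oriented (local_charts M))
  (hD : affine_connection D) (hDt : torsion_free D)
  (hvol : volume_form vol) (hDvol : preserves D vol)
  (hPhi : weighted_sym_tensor (2 / n.+1%:R) Phi)
  (hg : modified_pw_metric D vol Phi gbar)
  (hP : schouten_tensor gbar Pbar) :
  globally_ricci_flat_ambient_metric gbar
    (fun i z =>
       let t := coord_t z in
       let rho := coord_rho z in
       let y := lsubmx z in
       (2 * rho) *: odot (dt R (n + n)) (dt R (n + n))
       + (2 * t) *: odot (dt R (n + n)) (drho R (n + n))
       + t ^+ 2 *: pullback 2 (gbar i y + (2 * rho) *: Pbar i y)).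
Proof.
pose C := local_charts M.
have [[gT gU] gE] := hg; have [PT PE] := hP; have [D_smooth _] := hD.
have cdom_open (i : cindex C) : open (cdom i) by exact: chart_img_open.
pose Psi i x := vol i x `^ (2 / n.+1%:R) *: Phi i x.
(* the tensor on the base whose pullback is the Schouten tensor *)
pose Q i x := ((n + n)%:R - 2)^-1 *: (ricci (D i) x + (ricci (D i) x)^T).
have D_diff (i : cindex C) x : cdom i x ->
    forall c a b, differentiable (fun y => D i y c a b) x.
  by move=> xi c a b; exact: smooth_on_differentiable (D_smooth i c a b) xi.
have gpw (i : cindex C) (z : 'rV[R]_(n + n)) : cdom i (lsubmx z) ->
    gbar i z = pw_form (D i) (Psi i) z.
  move=> zi; rewrite gE//.
  exact: (@pw_formE _ _ _ (Psi i) _ (fun x xi => hDt i x xi)).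
have zero_section (i : cindex C) (T : field2 (cotangent C))
    (F : 'rV[R]_n -> 'M[R]_n) x A B :
    smooth_field2 T -> cdom i x ->
    (forall y, cdom i y ->
       T i (row_mx y 0) (lshift n A) (lshift n B) = F y A B) ->
    differentiable (fun y => F y A B) x.
  move=> Ts xi TF.
  have nx : nbhs x (cdom i) by exact: open_nbhs_nbhs.
  apply: differentiable_near_eq (filterS TF nx) _.
  apply: (@differentiable_zero_section _ _ _ (fun z => T i z _ _)).
  by apply: smooth_on_differentiable (Ts i _ _) _; rewrite /= row_mxKl.
have Psi_diff (i : cindex C) x : cdom i x ->
    forall a b, differentiable (fun y => Psi i y a b) x.
  move=> xi A B; have [gs _ _] := gT; apply: (zero_section i gbar) => // y yi.
  rewrite gpw ?row_mxKl// block_mxEul mxE row_mxKl row_mxKr.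
  by rewrite big1 ?mulr0 ?add0r// => K _; rewrite mxE mulr0.
have Psi_sym (i : cindex C) x : cdom i x ->
    forall a b, Psi i x a b = Psi i x b a.
  have [_ Phi_sym _] := hPhi.
  by move=> xi a b; rewrite !mxE -[in LHS](Phi_sym i x xi) mxE.
have D_sym (i : cindex C) x : cdom i x ->
    forall c a b, D i x c a b = D i x c b a.
  by move=> xi; exact: hDt.
have ocot (i : cindex C) : open [set z : 'rV[R]_(n + n) | cdom i (lsubmx z)].
  exact/open_pullback/cdom_open.
have Ppw (i : cindex C) (z : 'rV[R]_(n + n)) : cdom i (lsubmx z) ->
    Pbar i z = pullback n (Q i (lsubmx z)).
  move=> zi; rewrite PE//.
  rewrite -(schouten_pw (cdom_open i) (D_sym i) (D_diff i) (Psi_diff i))//.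
  exact: (schouten_eq_on (ocot i) zi (gpw i)).
have Q_diff (i : cindex C) x : cdom i x ->
    forall a b, differentiable (fun y => Q i y a b) x.
  move=> xi A B; have [Ps _ _] := PT; apply: (zero_section i Pbar) => // y yi.
  by rewrite Ppw ?row_mxKl// block_mxEul.
have Q_sym (i : cindex C) x : cdom i x -> forall a b, Q i x a b = Q i x b a.
  by move=> xi a b; rewrite ![Q i x _ _]mxE; congr (_ * _); rewrite !mxE addrC.
have Q_ricci (i : cindex C) x : cdom i x -> ricci (D i) x + (ricci (D i) x)^T
    = ((n + n)%:R - 2) *: Q i x.
  move=> xi; rewrite scalerA mulfV ?scale1r// subr_eq0 eqr_nat.
  by rewrite addnn -muln2 -[2%N in X in _ != X]mul1n eqn_pmul2r// gtn_eqF.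
have slice_unit (i : cindex C) y rho : cdom i (lsubmx y) ->
    slice (gbar i) (Pbar i) rho y \in unitmx.
  move=> yi; have := pw_form_unit (D i) (fun x => Psi i x + (2 * rho) *: Q i x) y.
  by rewrite -slice_pw /slice -gpw// Ppw.
have trans_diff (i j : cindex (cotangent C)) z :
    overlap i j z -> differentiable (trans i j) z.
  apply: differentiable_cotangent_trans.
  - exact: local_overlap_open.
  - exact: local_trans_overlap.
  - exact: local_trans_smooth.
pose h rho i := slice (gbar i) (Pbar i) rho.
split.
- exists h; split.
  + split=> [rho|i a b].
      by split; [exact: sym_tensor_slice|move=> i y; exact: slice_unit].
    exact: smooth_slice_family.
  + by move=> i y _; rewrite /h /slice mulr0 scale0r addr0.
  + by [].
- exact: metric_fg_form.
- move=> i z [zi tpos].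
  have oV : open
      [set z : 'rV[R]_(n + n + 2) | @cdom R n C i (lsubmx (lsubmx z))].
    exact: open_pullback (ocot i).
  have flat := ricci_ambient_pw (cdom_open i) (D_sym i) (D_diff i) (Psi_sym i)
    (Psi_diff i) (Q_sym i) (Q_diff i) (Q_ricci i) zi tpos.
  apply: (etrans _ flat); apply: (ricci_metric_eq_on oV) => // y yi.
  by rewrite /fg_form /slice gpw// Ppw.
Qed.
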